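(* Let $\alpha>3$ be a quadratic unit whose conjugate $\alpha_2$ is positive; thus $\alpha$ is a root of $x^2-bx+1$ for an integer $b$. Define integer sequences $(p_n)_{n\ge0}$, $(q_n)_{n\ge0}$ by \[ p_0=0,\ p_2=1,\ p_{2n+2}=bp_{2n}-p_{2n-2},\ p_{2n-1}=p_{2n-2}+p_{2n}, \] \[ q_0=1,\ q_2=1+b,\ q_{2n+2}=bq_{2n}-q_{2n-2},\ q_{2n-1}=q_{2n-2}+q_{2n} \] for all integers $n\ge1$. Then $(p_n/q_n)_{n\ge 0}$ is strictly increasing and converges to $1/(1+\alpha)$, and \[ \left\{\limsup_{m\to\infty}\|\xi\alpha^m\| : \xi\in\mathbb{R}\right\}\cap\left[0,\frac{1}{1+\alpha}\right]=\left\{\frac{p_n}{q_n} : n=0,1,2,\ldots\right\}\cup\left\{\frac1{1+\alpha}\right\}. \] Moreover, for each $n\ge0$ the set $X_n=\{\xi\in\mathbb{R} : \limsup_{m\to\infty}\|\xi\alpha^m\|=p_n/q_n\}$ is a subset of $\mathbb{Q}(\alpha)$, and the set $X_\infty=\{\xi\in\mathbb{R} : \limsup_{m\to\infty}\|\xi\alpha^m\|=1/(1+\alpha)\}$ is uncountable.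
   Context: $\|x\|$ denotes the distance from the real number $x$ to the nearest integer. *)

(* Defs.v *)
From HB Require Import structures.
From mathcomp Require Import all_boot all_order all_algebra.
From mathcomp Require Import all_classical all_reals all_analysis.

Set Implicit Arguments.
Unset Strict Implicit.
Unset Printing Implicit Defensive.

Import Order.TTheory GRing.Theory Num.Theory.
Import numFieldNormedType.Exports.

Local Open Scope classical_set_scope.
Local Open Scope ring_scope.

Definition algebraic_integer (R : realType) (x : R) : Prop :=
  integralOver (intr : int -> R) x.

(* In MathComp 0^-1 = 0, hence the explicit x != 0. *)
Definition algebraic_unit (R : realType) (x : R) : Prop :=
  [/\ x != 0, algebraic_integer x & algebraic_integer x^-1].

Definition is_minpolyQ (R : realType) (f : {poly rat}) (x : R) : Prop :=
  [/\ f \is monic, irreducible_poly f & root (map_poly (ratr : rat -> R) f) x].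

Definition quadratic_number (R : realType) (x : R) : Prop :=
  exists2 f : {poly rat}, is_minpolyQ f x & size f = 3%N.

Definition quadratic_unit (R : realType) (x : R) : Prop :=
  quadratic_number x /\ algebraic_unit x.

(* For quadratic x this determines y: the other root of a real quadratic
   polynomial with one real root is real. *)
Definition conjugate_of (R : realType) (x y : R) : Prop :=
  y != x /\ exists2 f : {poly rat}, is_minpolyQ f x & is_minpolyQ f y.

Definition dist_int (R : realType) (x : R) : R :=
  inf [set `|x - n%:~R| | n in [set: int]].

(* The sequence of distances takes values in [0, 1/2], so the real-valued
   limn_sup is its genuine upper limit. *)
Definition limsup_dist (R : realType) (alpha xi : R) : R :=
  limn_sup (fun m : nat => dist_int (xi * alpha ^+ m)).

Definition even_odd_recurrence (b : int) (u : nat -> int) : Prop :=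
  forall n : nat, (1 <= n)%N ->
    u (2 * n + 2)%N = b * u (2 * n)%N - u (2 * n - 2)%N /\
    u (2 * n - 1)%N = u (2 * n - 2)%N + u (2 * n)%N.

(* Q(x), as the smallest subfield of R containing x. *)
Definition Q_adjoin (R : realType) (x : R) : set R :=
  smallest (fun K : set R => divring_closed (mem K)) [set x].

(* Main.v *)
Require Import Defs.
From HB Require Import structures.
From mathcomp Require Import all_boot all_order all_algebra.
From mathcomp Require Import all_classical all_reals all_analysis.
From mathcomp Require Import zify ring lra.

(* Let e_m be the signed distance of xi alpha^m to a nearest integer u_m, and
   s_m = u_{m+1} - b u_m + u_{m-1}. If the upper limit of |e_m| is below 1/(1+alpha),
   then s_m lies in {-1, 0, 1} and its nonzero values alternate in sign, so
   s_m = c_{m+1} - c_m for a binary word c, and (alpha - 1/alpha) e_m equals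
   kap s_m + f_m - g_m, where kap = 1 - 1/alpha, and f_m / kap, g_m / kap are the base
   alpha expansions of c read to the right of m+1 and to the left of m. Since alpha > 3,
   expansions compare lexicographically, and the bound on e_m says exactly that c
   satisfies Markoff's condition: at each factor 01 or 10, the words read outwards from
   it first differ within bounded distance, and by the two letters in the reverse order.
   Desubstituting 0 -> 0, 1 -> 01 shortens that distance, hence c is eventually a
   Christoffel word of some period N. Its largest deviation occurs at the central
   palindrome and depends on N only; it is p_{N-1}/q_{N-1}. Periodicity of c puts xi in
   Q(alpha). Conversely each N > 1 is realised by the word of period 0^{N-1} 1, N = 1 by
   a constant word, and the threshold 1/(1+alpha) by words with ever sparser letters 1. *)

Set Implicit Arguments.
Unset Strict Implicit.
Unset Printing Implicit Defensive.

Import Order.TTheory GRing.Theory Num.Theory.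
Import numFieldNormedType.Exports.

(** * Words with the Markoff property *)

(* The margin [K] in [M + K <= m] keeps the subtractions [m - j] from being truncated. *)
Definition markoff (K M : nat) (c : nat -> bool) : Prop :=
  forall m, M + K <= m -> c m != c m.+1 ->
  exists d, [/\ 0 < d <= K, forall j, 0 < j < d -> c (m - j) = c (m.+1 + j),
                c (m - d) = c m.+1 & c (m.+1 + d) = c m].

(* For [N > 1]: up to a prefix, [c] repeats a conjugate of 01w, where w is a palindrome
   of length [N - 2]. *)
Definition christoffel (N : nat) (c : nat -> bool) : Prop :=
  [/\ 0 < N, exists M, forall m, M <= m -> c (m + N) = c m &
    1 < N -> forall M, exists m, [/\ M <= m, c m != c m.+1 &
      forall j, 0 < j < N.-1 -> c (m - j) = c (m.+1 + j)]].

Lemma markoff_negb K M c : markoff K M c -> markoff K M (fun i => ~~ c i).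
Proof.
move=> H m Mm neq; have /(H m Mm) [d [d1 d2 d3 d4]] : c m != c m.+1.
  by move: neq; case: (c m); case: (c m.+1).
by exists d; split => // [j /d2 ->|/=|/=]; rewrite ?d3 ?d4.
Qed.

Lemma christoffel_negb N c : christoffel N (fun i => ~~ c i) -> christoffel N c.
Proof.
move=> [N0 [M per] tr]; split => //.
  by exists M => m /per /negb_inj.
move=> /tr {}tr M'; have [m [Mm neq pal]] := tr M'; exists m; split => //.
  by move: neq; case: (c m); case: (c m.+1).
by move=> j /pal /negb_inj.
Qed.

Lemma markoff_shift K M p c : markoff K M c -> markoff K M (fun i => c (p + i)).
Proof.
move=> H m Mm; rewrite addnS => neq.
have [|d [d1 d2 d3 d4]] := H (p + m) _ neq; first by lia.
exists d; split => //.
- move=> j jd; rewrite [p + (m - j)](_ : _ = p + m - j); last by lia.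
  by rewrite (d2 j jd); congr c; lia.
- by rewrite -d3; congr c; lia.
- by rewrite -d4; congr c; lia.
Qed.

Lemma christoffel_shift N p c :
  christoffel N (fun i => c (p + i)) -> christoffel N c.
Proof.
move=> [N0 [M per] tr]; split => //.
  exists (p + M) => m Mm; have := per (m - p).
  by rewrite addnA subnKC; [apply; lia|lia].
move=> /tr {}tr M'; have [m [Mm neq pal]] := tr (M' + N); exists (p + m); split.
- by lia.
- by rewrite -addnS.
- move=> j jN; have := pal j jN; rewrite [p + (m - j)](_ : _ = p + m - j); last by lia.
  by move=> ->; congr c; lia.
Qed.

(* A descent: the mirror condition at the first transition after [aa] produces,
   further left, a closer pair of doubled letters. *)
Lemma markoff_no_double K M c : markoff K M c -> forall n m a,
  M + K + K * minn n K.+1 <= m ->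
  c m = a -> c m.+1 = a -> c (m + n) = ~~ a -> c (m + n).+1 = ~~ a -> False.
Proof.
(* Only moves to the left cost margin. Each has the length of the new distance, which is below [K],
   so the total cost is bounded independently of [n]; hence the [minn]. *)
move=> H; elim/ltn_ind => n IH m a Mm c0 c1 cn cn1.
case: n IH Mm cn cn1 => [|[|n]] IH Mm cn cn1.
- by move: cn; rewrite addn0 c0; case: (a).
- by move: cn; rewrite addn1 c1; case: (a).
(* A doubled letter strictly in between gives a closer pair at once, on one side or the other. So
   the letters may be assumed to alternate from [m.+1] to [m + n.+2]. *)
case: (boolP [exists i : 'I_n.+2, (0 < i) && (c (m + i) == c (m + i).+1)]).
  move=> /existsP[i /andP[i0 /eqP ci]]; have ltin := ltn_ord i.
  have le1 : K * minn (n.+2 - i) K.+1 <= K * minn n.+2 K.+1.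
    by rewrite leq_mul2l; lia.
  have le2 : K * minn i K.+1 <= K * minn n.+2 K.+1.
    by rewrite leq_mul2l; lia.
  case: (eqVneq (c (m + i)) a) => cia.
    apply: (IH (n.+2 - i) _ (m + i) a); rewrite -?ci // ?addnA.
    - by lia.
    - by lia.
    - by rewrite [m + i + _](_ : _ = m + n.+2) //; lia.
    - by rewrite [m + i + _](_ : _ = m + n.+2) //; lia.
  have cia' : c (m + i) = ~~ a by move: cia; case: (c _); case: (a).
  by apply: (IH i _ m a); rewrite -?ci //; lia.
rewrite negb_exists => /forallP alt.
have {}alt i : 0 < i < n.+2 -> c (m + i).+1 = ~~ c (m + i).
  move=> /andP[i0 ilt]; have := alt (Ordinal ilt); rewrite /= i0 /=.
  by case: (c _); case: (c _).
have c2 : c m.+2 = ~~ a by have := alt 1 isT; rewrite addn1 c1.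
have MKm : M + K <= m by apply: leq_trans Mm; apply: leq_addr.
have [||d [dK pal dl dr]] := H m.+1; first by lia.
  by rewrite c1 c2; case: (a).
have d1 : 1 < d.
  rewrite ltnNge; apply/negP => d1; have dE : d = 1 by lia.
  by move: dl; rewrite dE subn1 c0 c2; case: (a).
(* By alternation [c (m.+1 + d)] is [~~ a]. It mirrors to position [m.+2 - d], next to
   [c (m.+1 - d) = ~~ a]: a double at distance [d.-1] to the left of [aa]. *)
have [dn|dn] := leqP d n.
  apply: (IH d.-1 _ (m.+1 - d) (~~ a)); first by lia.
  - have : K * d <= K * minn n.+2 K.+1 by rewrite leq_mul2l; lia.
    have : K * minn d.-1 K.+1 <= K * d.-1 by rewrite leq_mul2l; lia.
    have : K * d = K * d.-1 + K by rewrite -mulnSr prednK //; lia.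
    lia.
  - by rewrite dl c2.
  - have := pal d.-1; rewrite [m.+1 - _](_ : _ = (m.+1 - d).+1); last by lia.
    move=> ->; last by lia.
    have := alt d.+1; rewrite [(m + d.+1).+1](_ : _ = m.+2 + d); last by lia.
    rewrite dr c1 => ->; last by lia.
    by rewrite negbK; congr c; lia.
  - by rewrite negbK [m.+1 - d + _](_ : _ = m) //; lia.
  - by rewrite negbK [m.+1 - d + _](_ : _ = m) //; lia.
(* For [d = n.+1] the first difference would fall on the double on the right, where the letter is
   wrong; for larger [d] that double is reflected whole to the left of [aa]. *)
have [dn'|dn'] := leqP d n.+1.
  move: dr; rewrite [m.+2 + d](_ : _ = (m + n.+2).+1); last by lia.
  by rewrite cn1 c1; case: (a).
have pr : c (m.+1 - n.+1) = ~~ a by rewrite pal -?cn1; [congr c|]; lia.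
case: n => [|n] in IH Mm cn cn1 alt dn dn' pr *.
  by move: pr; rewrite subn1 c0; case: (a).
apply: (IH n.+1 _ (m.+1 - n.+2) (~~ a)); first by lia.
- have : K * n.+3 <= K * minn n.+3 K.+1 by rewrite leq_mul2l; lia.
  have : K * minn n.+1 K.+1 <= K * n.+1 by rewrite leq_mul2l; lia.
  by rewrite (mulnS K n.+2) (mulnS K n.+1); lia.
- by [].
- have := pal n.+1; rewrite [m.+1 - n.+1](_ : _ = (m.+1 - n.+2).+1); last by lia.
  by move=> ->; [rewrite -cn; congr c; lia|lia].
- by rewrite negbK [m.+1 - n.+2 + _](_ : _ = m) //; lia.
- by rewrite negbK [m.+1 - n.+2 + _](_ : _ = m) //; lia.
Qed.

(** * Desubstitution of 0 -> 0, 1 -> 01 *)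

Section desubstitution.
Variable c : nat -> bool.

(* When [c] is the image of [c'] under the substitution 0 -> 0, 1 -> 01, the image of
   the letter [c' i] starts at position [dpos i]. *)
Fixpoint dpos (i : nat) : nat :=
  if i is i.+1 then dpos i + (c (dpos i).+1).+1 else 0.

Definition desub (i : nat) : bool := c (dpos i).+1.

Hypothesis c0 : c 0 = false.
Hypothesis c_isolated : forall m, c m -> c m.+1 = false.

Lemma dposS i : dpos i.+1 = dpos i + (desub i).+1. Proof. by []. Qed.

Lemma c_dpos i : c (dpos i) = false.
Proof.
elim: i => // i IH; rewrite dposS /desub.
case: (boolP (c (dpos i).+1)) => [/c_isolated|/negbTE] H; last by rewrite addn1.
by rewrite addn2.
Qed.

Lemma dpos_ge i : i <= dpos i.
Proof. by elim: i => // i; rewrite dposS; lia. Qed.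

Lemma dpos_le i j : i <= j -> dpos i <= dpos j.
Proof.
by move=> /subnK <-; elim: (j - i) => // k IH; rewrite addSn dposS; lia.
Qed.

Lemma dpos_cover p : exists i, p = dpos i \/ p = (dpos i).+1 /\ desub i.
Proof.
elim: p => [|p [i [->|[-> ci]]]]; first by exists 0; left.
  case: (boolP (desub i)) => ci; first by exists i; right.
  by exists i.+1; left; rewrite dposS (negbTE ci) addn1.
by exists i.+1; left; rewrite dposS ci addn2.
Qed.

(** Every image starts with 0, and moving that 0 across a block turns a reversed image into the
    image itself: 0 followed by 10 is 01 followed by 0. Hence a mirrored stretch of letters lifts to
    a mirrored stretch of their images, longer by one letter 0. *)
Lemma desub_mirror i t : t <= i ->
  (forall j, 0 < j <= t -> desub (i - j) = desub (i.+1 + j)) ->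
  dpos (i - t) + dpos (i.+2 + t) = dpos i + dpos i.+2 /\
  forall l, l <= dpos i - dpos (i - t) -> c (dpos i - l) = c (dpos i.+2 + l).
Proof.
elim: t => [|t IH] ti pal.
  rewrite subn0 addn0; split => // l; rewrite subnn leqn0 => /eqP ->.
  by rewrite subn0 addn0 !c_dpos.
have [||sum mir] := IH; [by lia|by move=> j jt; apply: pal; lia|].
have palt : desub (i - t.+1) = desub (i.+2 + t) by rewrite pal ?addSnnS //; lia.
have E1 : dpos (i - t) = dpos (i - t.+1) + (desub (i - t.+1)).+1.
  by rewrite -dposS; congr dpos; lia.
have E2 : dpos (i.+2 + t.+1) = dpos (i.+2 + t) + (desub (i - t.+1)).+1.
  by rewrite addnS dposS palt.
have le1 : dpos (i - t) <= dpos i by apply: dpos_le; lia.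
split; first by lia.
move=> l lL; have [|ltl] := leqP l (dpos i - dpos (i - t)); first exact: mir.
have [lE|lN] := eqVneq l (dpos i - dpos (i - t)).+1.
  rewrite (_ : dpos i.+2 + l = (dpos (i.+2 + t)).+1); last by lia.
  rewrite (_ : dpos i - l = dpos (i - t.+1) + desub (i - t.+1)); last by lia.
  rewrite -/(desub (i.+2 + t)) -palt.
  case: (boolP (desub (i - t.+1))) => d; last by rewrite addn0 c_dpos.
  by rewrite addn1; apply: d.
have d : desub (i - t.+1) by apply/negPn/negP => /negbTE d; move: lN; rewrite d in E1; lia.
rewrite d in E1 E2.
rewrite (_ : dpos i.+2 + l = dpos (i.+2 + t.+1)); last by lia.
by rewrite (_ : dpos i - l = dpos (i - t.+1)); [rewrite !c_dpos|lia].
Qed.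

(** The images of 01 and 10 are 001 and 010, so the last two of the three places repeat the two
    letters. *)
Lemma desub_transition i : desub i != desub i.+1 ->
  [/\ dpos i.+2 = dpos i + 3, c (dpos i).+1 = desub i & c (dpos i).+2 = desub i.+1].
Proof.
move=> neq; rewrite !dposS; split => //.
  by move: neq; case: (desub i); case: (desub i.+1) => //=; lia.
move: neq; have := dposS i; have : c (dpos i).+1 = desub i by [].
have : c (dpos i.+1).+1 = desub i.+1 by [].
case: (desub i); case: (desub i.+1) => // cS ci dS _.
  by rewrite c_isolated.
by rewrite -cS dS addn1.
Qed.

(** A transition lifts to a transition, and a first mirror difference at distance [t.+1] lifts to
    one at distance at least [t.+2]: the images of [t] letters fill at least [t] places and the
    extra 0 adds one more. So the bound drops by one. *)
Lemma markoff_desub K M : markoff K.+1 M c -> markoff K M desub.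
Proof.
move=> H i Mi neq; have [d3 cm cm1] := desub_transition neq.
have ige := dpos_ge i.
have [||d [dK pal dl dr]] := H (dpos i).+1; first by lia.
  by rewrite cm cm1.
have neqC : c (dpos i).+1 <> c (dpos i).+2 by apply/eqP; rewrite cm cm1.
have El l : (dpos i).+1 - l.+1 = dpos i - l by lia.
have Er l : (dpos i).+2 + l.+1 = dpos i.+2 + l by lia.
case: d => // d in dK pal dl dr *; rewrite El Er in dl dr.
have ext : exists t, (t < K) && (desub (i - t.+1) != desub (i.+2 + t)).
  case: (boolP [exists t : 'I_K, desub (i - t.+1) != desub (i.+2 + t)]).
    by move=> /existsP[t neqt]; exists t; rewrite ltn_ord.
  rewrite negb_exists => /forallP eqs.
  have [||sum mir] := @desub_mirror i K; first by lia.
    case=> // j jK; have jlt : j < K by lia.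
    by have := eqs (Ordinal jlt); rewrite negbK /= -addSnnS => /eqP.
  exfalso; have dK' : d <= dpos i - dpos (i - K).
    suff : forall t, t <= i -> t <= dpos i - dpos (i - t) by move=> /(_ K); lia.
    elim=> // t IHt ti; have := IHt (ltnW ti).
    rewrite (_ : i - t = (i - t.+1).+1) ?dposS; last by lia.
    have : dpos (i - t.+1).+1 <= dpos i by apply: dpos_le; lia.
    by rewrite dposS; lia.
  by have := mir d dK'; rewrite dl dr => /esym.
case: (ex_minnP ext) => t /andP[tK neqt] tmin.
have palt j : 0 < j <= t -> desub (i - j) = desub (i.+1 + j).
  case: j => // j jt; apply/eqP/negPn/negP => neqj.
  by have := tmin j; rewrite addSnnS neqj andbT; lia.
have [|sum mir] := @desub_mirror i t _ palt; first by lia.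
have le1 : dpos (i - t) <= dpos i by apply: dpos_le; lia.
set L := dpos i - dpos (i - t) in mir.
have Ll : c (dpos i - L.+1) = desub (i - t.+1).
  have E1 : dpos (i - t) = dpos (i - t.+1) + (desub (i - t.+1)).+1.
    by rewrite -dposS; congr dpos; lia.
  rewrite (_ : dpos i - L.+1 = dpos (i - t.+1) + desub (i - t.+1)); last by lia.
  case: (boolP (desub (i - t.+1))) => de; last by rewrite addn0 c_dpos.
  by rewrite addn1; apply: de.
have Lr : c (dpos i.+2 + L.+1) = desub (i.+2 + t).
  by rewrite /desub; congr c; lia.
have dE : d = L.+1.
  have [dL|dL] := leqP d L.
    by have := mir d dL; rewrite dl dr => /esym.
  have [//|dn] := eqVneq d L.+1.
  have := pal L.+2; rewrite El Er Ll Lr => e; move: neqt; rewrite e ?eqxx //; lia.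
exists t.+1; split; first by lia.
- by move=> j jt; apply: palt; lia.
- by rewrite -Ll -dE dl cm1.
- by rewrite -addSnnS -Lr -dE dr cm.
Qed.

(** The new period is the length of the image of [N] consecutive letters, and the palindrome lifts
    by [desub_mirror]. *)
Lemma christoffel_desub N : christoffel N desub -> exists N', christoffel N' c.
Proof.
move=> [N0 [M per] tr].
have dper i : M <= i -> dpos (i + N) = dpos i + (dpos (M + N) - dpos M).
  move=> /subnK <-; elim: (i - M) => [|k IH].
    by rewrite add0n; have : dpos M <= dpos (M + N); [apply: dpos_le|]; lia.
  by rewrite !addSn !dposS IH per; lia.
have dlt : dpos M < dpos (M + N).
  apply: (@leq_trans (dpos M.+1)); first by rewrite dposS; lia.
  by apply: dpos_le; lia.
set N' := dpos (M + N) - dpos M in dper.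
have cper p : dpos M <= p -> c (p + N') = c p.
  move=> Mp; have [i [pE|[pE ci]]] := dpos_cover p.
    have Mi : M <= i.
      by rewrite leqNgt; apply/negP => iM; have := dpos_le iM; rewrite dposS; lia.
    by rewrite pE -dper // !c_dpos.
  have Mi : M <= i.
    by rewrite leqNgt; apply/negP => iM; have := dpos_le iM; rewrite dposS ci; lia.
  by rewrite pE addSn -dper // -!/(desub _) per.
exists N'; split; [by lia|by exists (dpos M)|move=> N'1].
have [N1|N1] := eqVneq N 1.
  have desM : desub M.
    by apply/negPn/negP => /negbTE e; move: N'1; rewrite /N' N1 addn1 dposS e; lia.
  have desk k : desub (M + k).
    by elim: k => [|k IH]; rewrite ?addn0 // addnS -addn1 -N1 per //; lia.
  have N'2 : N' = 2 by rewrite /N' N1 addn1 dposS desM; lia.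
  move=> M'; exists (dpos (M + M')); split.
  - by have := dpos_ge (M + M'); lia.
  - by rewrite c_dpos -/(desub _) desk.
  - by rewrite N'2 => j; lia.
move=> M'; have [|i [Mi neq pal]] := tr _ (M' + M + N); first by lia.
have [d3 cm cm1] := desub_transition neq.
have [||sum mir] := @desub_mirror i N.-2; first by lia.
  by move=> j jN; apply: pal; lia.
have ige := dpos_ge i.
have le1 : dpos (i - N.-2) <= dpos i by apply: dpos_le; lia.
have N'E : N' = (dpos i - dpos (i - N.-2)) + 3.
  by have := dper (i - N.-2); rewrite (_ : i - N.-2 + N = i.+2); lia.
exists (dpos i).+1; split; [by lia|by rewrite cm cm1|].
case=> // j jN; have := mir j; rewrite (_ : (dpos i).+1 - j.+1 = dpos i - j); last by lia.
by rewrite (_ : (dpos i).+2 + j.+1 = dpos i.+2 + j); [apply|]; lia.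
Qed.

End desubstitution.

(** Induction on [K]. Far out, 00 and 11 cannot both occur, so up to exchanging the letters 1 is
    isolated, and desubstitution lowers [K]. For [K = 0] no transitions are left and the word is
    eventually constant. *)
Lemma markoff_christoffel K M c : markoff K M c -> exists N, christoffel N c.
Proof.
elim: K M c => [|K IH] M c H.
  exists 1; split => //; exists M => m Mm; apply/esym/eqP/negPn/negP.
  rewrite addn1 => neq; have [|d [dK _ _ _]] := H m _ neq; first by lia.
  by move: dK; case: (d).
have iso c' p : markoff K.+1 M c' -> (forall m, p <= m -> c' m -> c' m.+1 = false) ->
    exists N, christoffel N c'.
  move=> H' iso.
  have [q pq cq] : exists2 q, p <= q & c' q = false.
    by case: (boolP (c' p)) => [/iso|/negbTE] cp; [exists p.+1; rewrite ?cp|exists p].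
  have c0 : c' (q + 0) = false by rewrite addn0.
  have isoq m : c' (q + m) -> c' (q + m.+1) = false by rewrite addnS; apply: iso; lia.
  have [N chr] := IH M _ (markoff_desub c0 isoq (markoff_shift (p := q) H')).
  have [N' chr'] := christoffel_desub c0 isoq chr.
  by exists N'; apply: christoffel_shift chr'.
set B := M + K.+1 + K.+1 * K.+2.
have Bn n : M + K.+1 + K.+1 * minn n K.+2 <= B by rewrite leq_add2l leq_mul2l; lia.
have [[p [Bp cp cp1]]|no11] :=
    pselect (exists p, [/\ B <= p, c p = true & c p.+1 = true]).
  have [|N chr] := iso (fun i => ~~ c i) p (markoff_negb H); last first.
    by exists N; apply: christoffel_negb.
  move=> m pm /= cm; apply/negbF/negPn/negP => cm1; move: pm => /subnKC mE.
  apply: (markoff_no_double H (n := m - p) (m := p) (a := true)); rewrite ?mE //=.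
  - by apply: leq_trans (Bn _) _.
  - exact/negbTE.
  - exact/negbTE.
apply: (iso c B) => // m Bm cm; apply/negbTE/negP => cm1.
by apply: no11; exists m.
Qed.

Local Open Scope classical_set_scope.
Local Open Scope ring_scope.

(** * Base 1/be expansions read from a word in both directions *)

Definition upper_limit (R : realType) (u : nat -> R) (v : R) : Prop :=
  (forall d, 0 < d -> exists M, forall m, (M <= m)%N -> u m <= v + d) /\
  (forall d, 0 < d -> forall M, exists2 m, (M <= m)%N & v - d <= u m).

Section digit_systems.
Variables (R : realType) (be : R).
Hypotheses (be0 : 0 < be) (be3 : 3 * be < 1).

Lemma nat_bool_itv (b : bool) : 0 <= (b%:R : R) <= 1.
Proof. by case: b; rewrite /= ?lexx ler01. Qed.

Lemma expr_small eta : 0 < eta -> exists K, forall n, (K <= n)%N -> be ^+ n < eta.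
Proof.
have b0 := be0; have b3 := be3.
move=> eta0; have : `|be| < 1 by rewrite gtr0_norm //; lra.
move=> /(@cvg_expr R) /cvgrPdist_lt /(_ _ eta0) [K _ HK].
exists K => n Kn; have := HK n Kn.
by rewrite /= sub0r normrN ger0_norm // exprn_ge0 // ltW.
Qed.

Lemma expr_le_base n : (0 < n)%N -> be ^+ n <= be.
Proof.
have b0 := be0; have b3 := be3.
by move=> n0; rewrite -[leRHS]expr1 ler_wiXn2l ?(ltW b0) //; lra.
Qed.

Lemma expr_bound_ge0 (x B : R) : (forall n, - (be ^+ n * B) <= x) -> 0 <= x.
Proof.
have b0 := be0; have b3 := be3.
move=> H; rewrite leNgt; apply/negP => x0.
have B1 : 0 < `|B| + 1 by apply: ltr_wpDl.
have xB : 0 < - x / (`|B| + 1) by rewrite divr_gt0 // oppr_gt0.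
have [K /(_ K (leqnn _)) HK] := expr_small xB.
move: HK; rewrite ltr_pdivlMr // => HK.
have := H K; have e0 : 0 < be ^+ K by rewrite exprn_gt0.
have : be ^+ K * B <= be ^+ K * (`|B| + 1).
  by rewrite ler_wpM2l // ?ltW //; have := ler_norm B; lra.
by lra.
Qed.

Lemma expr_bound_eq0 (x B : R) : (forall n, `|x| <= be ^+ n * B) -> x = 0.
Proof.
have b0 := be0; have b3 := be3.
move=> H; apply/eqP; rewrite -normr_eq0 eq_le normr_ge0 andbT -oppr_ge0.
by apply: (@expr_bound_ge0 _ B) => n; rewrite lerN2.
Qed.

Local Notation kap := (1 - be).
Implicit Types (c : nat -> bool) (f g : nat -> R).

(* [f m] and [g m] are [kap] times the base [1 / be] expansions whose digits are the
   letters of [c] read rightwards from [m + 2], respectively leftwards from [m - 1]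
   (the latter up to a term decaying with [m]). *)
Definition digit_system c f g : Prop :=
  [/\ forall m, f m = be * (kap * (c m.+2)%:R + f m.+1),
      forall m, g m.+1 = be * (kap * (c m)%:R + g m),
      forall m, 0 <= f m <= be & forall m, - be <= g m <= 2 * be].

Definition deviation c f g (m : nat) : R :=
  kap * ((c m.+1)%:R - (c m)%:R) + f m - g m.

Lemma left_expansion_bounds c g :
  (forall m, g m.+1 = be * (kap * (c m)%:R + g m)) -> (forall m, - be <= g m <= 2 * be) ->
  forall d, 0 < d -> exists M, forall m, (M <= m)%N -> - d <= g m <= be + d.
Proof.
have b0 := be0; have b3 := be3.
move=> gE gB d d0; have [K HK] := expr_small d0; exists K => m /HK bm.
have c01 i := nat_bool_itv (c i).
(* The unknown initial value contributes an error that each step of the recursion multiplies by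
   [be]. *)
suff : - be ^+ m <= g m <= be + be ^+ m by lra.
elim: m {bm} => [|m IH]; first by rewrite expr0; have := gB 0%N; lra.
have e0 : 0 <= be ^+ m by rewrite exprn_ge0 // ltW.
rewrite gE exprS; have /andP[c0 c1] := c01 m.
have h1 : 0 <= kap * (c m)%:R <= kap.
  by rewrite mulr_ge0 /=; rewrite ?ler_piMr //; lra.
rewrite -[X in _ <= _ <= X + _]mulr1 -mulrDr -mulrN !ler_pM2l //; lra.
Qed.

Lemma digit_mirror c f g m n : digit_system c f g -> (n <= m)%N ->
  (forall j, (0 < j <= n)%N -> c (m - j)%N = c (m.+1 + j)%N) ->
  f m - g m = be ^+ n * (f (m + n)%N - g (m - n)%N).
Proof.
have b0 := be0; have b3 := be3.
move=> [fE gE _ _]; elim: n => [|n IH] nm pal.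
  by rewrite expr0 mul1r addn0 subn0.
rewrite IH; [|lia|by move=> j jn; apply: pal; lia].
rewrite fE (_ : m - n = (m - n.+1).+1)%N; last by lia.
rewrite gE exprSr addnS -mulrA -mulrBr pal ?addSnnS ?addnS; last by lia.
by congr (_ * (_ * _)); ring.
Qed.

Lemma digit_first_difference c f g m d : digit_system c f g -> (0 < d <= m)%N ->
  (forall j, (0 < j < d)%N -> c (m - j)%N = c (m.+1 + j)%N) ->
  f m - g m = be ^+ d * (kap * ((c (m.+1 + d)%N)%:R - (c (m - d)%N)%:R)
                         + (f (m + d)%N - g (m - d)%N)).
Proof.
have b0 := be0; have b3 := be3.
move=> sys; case: d => // d dm pal; have [fE gE _ _] := sys.
rewrite (@digit_mirror c f g m d) //; last by lia.
rewrite fE (_ : m - d = (m - d.+1).+1)%N; last by lia.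
by rewrite gE exprSr addnS -mulrA -mulrBr !addSn addnS; congr (_ * (_ * _)); ring.
Qed.

(** If [K] letters agreed, [digit_mirror] would bound the difference by [be ^+ K], since the tails
    differ by at most [2 * be < 1]. *)
Lemma exists_first_difference c f g m K : digit_system c f g -> (K <= m)%N ->
  be ^+ K < `|f m - g m| ->
  exists d, [/\ (0 < d <= K)%N,
    forall j, (0 < j < d)%N -> c (m - j)%N = c (m.+1 + j)%N &
    c (m - d)%N != c (m.+1 + d)%N].
Proof.
have b0 := be0; have b3 := be3.
move=> sys Km far; have [_ _ fB gB] := sys.
have ex : exists d, (0 < d <= K)%N && (c (m - d)%N != c (m.+1 + d)%N).
  case: (boolP [exists j : 'I_K, c (m - j.+1)%N != c (m.+1 + j.+1)%N]).
    by move=> /existsP[j neqj]; exists j.+1; rewrite neqj ltn_ord.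
  rewrite negb_exists => /forallP eqs; exfalso; move: far.
  rewrite (@digit_mirror c f g m K) //; last first.
    case=> // j jK; have jlt : (j < K)%N by lia.
    by have := eqs (Ordinal jlt); rewrite negbK => /eqP.
  have e0 : 0 < be ^+ K by rewrite exprn_gt0.
  rewrite normrM (gtr0_norm e0) ltr_pMr // ltNge ler_norml.
  by have := fB (m + K)%N; have := gB (m - K)%N; lra.
case: (ex_minnP ex) => d /andP[dK neqd] dmin; exists d; split => // j jd.
by apply/eqP/negPn/negP => neqj; have := dmin j; rewrite neqj andbT; lia.
Qed.

(** At a transition the main term has modulus [kap], so the bound forces [f m - g m] to have the
    opposite sign and modulus at least [eta]. Hence a first difference occurs within bounded
    distance, and as [kap > 2 * be] it decides the sign, which fixes the order of its two
    letters. *)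
Lemma deviation_markoff c f g (eta : R) M : digit_system c f g -> 0 < eta ->
  (forall m, (M <= m)%N -> `|deviation c f g m| <= kap - eta) ->
  exists K M', markoff K M' c.
Proof.
have b0 := be0; have b3 := be3.
move=> sys eta0 small; have [K /(_ K (leqnn _)) HK] := expr_small eta0.
exists K, M => m Mm neq; have [fE gE fB gB] := sys.
have := small m ltac:(lia); rewrite ler_norml => /andP[dev1 dev2].
have far : be ^+ K < `|f m - g m|.
  apply: (lt_le_trans HK); rewrite ler_normr.
  apply/orP; rewrite /deviation in dev1 dev2; move: dev1 dev2 neq.
  by case: (c m); case: (c m.+1) => //= dev1 dev2 _; [left|right]; lra.
have Km : (K <= m)%N by clear -Mm; lia.
have [d [dK pal neqd]] := exists_first_difference sys Km far.
exists d; have dm : (0 < d <= m)%N by clear -dK Km; lia.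
have := digit_first_difference sys dm pal; move: dev1 dev2 neq neqd pal.
rewrite /deviation.
have := fB (m + d)%N; have := gB (m - d)%N; have e0 : 0 < be ^+ d by rewrite exprn_gt0.
case: (c (m - d)%N); case: (c (m.+1 + d)%N); case: (c m); case: (c m.+1) => //=;
  move=> gd fd dev1 dev2 _ _ pal E.
- have : 0 <= be ^+ d * - (kap * (0 - 1) + (f (m + d)%N - g (m - d)%N)).
    by rewrite mulr_ge0 ?(ltW e0) //; lra.
  by rewrite mulrN -E; lra.
- have : 0 <= be ^+ d * (kap * (1 - 0) + (f (m + d)%N - g (m - d)%N)).
    by rewrite mulr_ge0 ?(ltW e0) //; lra.
  by rewrite -E; lra.
Qed.

Lemma right_expansion_periodic c f N M :
  (forall m, f m = be * (kap * (c m.+2)%:R + f m.+1)) -> (forall m, 0 <= f m <= be) ->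
  (forall m, (M <= m)%N -> c (m + N)%N = c m) ->
  forall m, (M <= m)%N -> f (m + N)%N = f m.
Proof.
have b0 := be0; have b3 := be3.
move=> fE fB per m Mm; apply/eqP; rewrite -subr_eq0; apply/eqP.
apply: (@expr_bound_eq0 _ 1) => n; elim: n m Mm => [|n IH] m Mm.
  by rewrite expr0 mul1r ler_norml; have := fB m; have := fB (m + N)%N; lra.
rewrite (fE m) (fE (m + N)%N) -!addSn per; last by lia.
rewrite -mulrBr opprD addrACA subrr add0r normrM (gtr0_norm b0) exprS -mulrA.
by rewrite ler_pM2l // IH //; lia.
Qed.

(** Unlike [f], which the letters determine, [g] remembers its initial value, so its periodicity is
    only asymptotic. *)
Lemma left_expansion_periodic c g N M :
  (forall m, g m.+1 = be * (kap * (c m)%:R + g m)) -> (forall m, - be <= g m <= 2 * be) ->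
  (forall m, (M <= m)%N -> c (m + N)%N = c m) ->
  forall d, 0 < d -> exists M', forall m, (M' <= m)%N -> `|g (m + N)%N - g m| <= d.
Proof.
have b0 := be0; have b3 := be3.
move=> gE gB per d d0; have [K HK] := expr_small d0.
have small n : `|g (M + n + N)%N - g (M + n)%N| <= be ^+ n.
  elim: n => [|n IH].
    by rewrite expr0 ler_norml; have := gB (M + 0)%N; have := gB (M + 0 + N)%N; lra.
  rewrite addnS addSn !gE per; last by lia.
  rewrite -mulrBr opprD addrACA subrr add0r normrM (gtr0_norm b0) exprS.
  by rewrite ler_pM2l.
exists (M + K)%N => m Mm; have := small (m - M)%N; rewrite subnKC; last by lia.
by move=> /le_trans; apply; apply/ltW/HK; lia.
Qed.

(** Beyond the palindrome, the next two letters on either side are those of the transition, in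
    opposite orders; one period away [f] repeats and [g] nearly does. This yields a linear equation
    for [f m - g m]. *)
Lemma digit_palindrome c f g m N : digit_system c f g -> (1 < N)%N -> (N <= m)%N ->
  c m != c m.+1 ->
  (forall j, (0 < j < N.-1)%N -> c (m - j)%N = c (m.+1 + j)%N) ->
  c (m - N)%N = c m -> c (m - N.-1)%N = c m.+1 ->
  c (m + N)%N = c m -> c (m.+1 + N)%N = c m.+1 -> f (m + N)%N = f m ->
  (f m - g m) * (1 - be ^+ N) =
  - (kap * be ^+ N.-1 * (1 - be)) * ((c m.+1)%:R - (c m)%:R)
   + be ^+ N * (g m - g (m - N)%N).
Proof.
have b0 := be0; have b3 := be3.
case: N => [|[|N]] // sys _ Nm neq pal cl cl1 cr cr1 fN; have [fE gE _ _] := sys.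
have E : f m - g m = be ^+ N.+1 * (kap * ((c m)%:R - (c m.+1)%:R)
           + (f (m + N.+1)%N - g (m - N.+1)%N)).
  rewrite (@digit_mirror c f g m N) //; last by lia.
  rewrite fE (_ : m - N = (m - N.+1).+1)%N; last by lia.
  rewrite gE exprSr -mulrA -mulrBr cl1.
  rewrite (_ : (m + N).+2 = m + N.+2)%N; last by lia.
  by rewrite cr -addnS; congr (_ * (_ * _)); ring.
rewrite mulrBr mulr1 {1}E fE (_ : m - N.+1 = (m - N.+2).+1)%N; last by lia.
rewrite gE cl (_ : (m + N.+1).+2 = m.+1 + N.+2)%N; last by lia.
by rewrite cr1 -addnS fN !exprS /=; ring.
Qed.

(** The limit of [|f m - g m|] at the centre of the palindrome, found by solving [digit_palindrome]
    with [g] exactly periodic. For [N = 1] it equals [kap], so that a constant word gets the value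
    0. *)
Definition period_gap (N : nat) : R := kap ^+ 2 * be ^+ N.-1 / (1 - be ^+ N).

Lemma period_gapE N : (0 < N)%N ->
  period_gap N * (1 - be ^+ N) = kap ^+ 2 * be ^+ N.-1.
Proof.
have b0 := be0; have b3 := be3.
move=> N0; rewrite /period_gap divfK // subr_eq0 eq_sym lt_eqF // exprn_ilt1 //; lra || lia.
Qed.

Lemma period_gap_bounds N : (1 < N)%N ->
  0 < period_gap N <= kap * be ^+ N.-1.
Proof.
have b0 := be0; have b3 := be3.
move=> N1; have E := @period_gapE N (ltnW N1).
have e1 : be ^+ N <= be ^+ 2 by rewrite ler_wiXn2l // ?(ltW be0) //; lra.
have e2 : 0 < be ^+ N.-1 by rewrite exprn_gt0.
have e3 : be ^+ 2 <= be by rewrite expr2; nra.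
have p : 0 < 1 - be ^+ N by lra.
apply/andP; split.
  by rewrite -(pmulr_lgt0 _ p) E mulr_gt0 // exprn_gt0 //; lra.
rewrite -(ler_pM2r p) E.
have : 0 <= kap * be ^+ N.-1 * (be - be ^+ N) by rewrite !mulr_ge0 ?(ltW e2) //; lra.
by rewrite expr2; lra.
Qed.

Lemma palindrome_deviation c f g m N (d : R) : digit_system c f g -> (1 < N)%N ->
  (N <= m)%N -> c m != c m.+1 ->
  (forall j, (0 < j < N.-1)%N -> c (m - j)%N = c (m.+1 + j)%N) ->
  c (m - N)%N = c m -> c (m - N.-1)%N = c m.+1 ->
  c (m + N)%N = c m -> c (m.+1 + N)%N = c m.+1 -> f (m + N)%N = f m ->
  `|g m - g (m - N)%N| <= d ->
  kap - period_gap N - d <= `|deviation c f g m| <= kap - period_gap N + d.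
Proof.
have b0 := be0; have b3 := be3.
move=> sys N1; have [N0 N1'] : (0 < N)%N /\ (0 < N.-1)%N by lia.
move=> Nm neq pal cl cl1 cr cr1 fN gd.
have := digit_palindrome sys N1 Nm neq pal cl cl1 cr cr1 fN.
have gapE := period_gapE (ltnW N1).
have e1 : be ^+ N <= be by apply: expr_le_base.
have e2 : 0 < be ^+ N by rewrite exprn_gt0.
have p : 0 < 1 - be ^+ N by lra.
set s := (c m.+1)%:R - (c m)%:R; set D := g m - _ => E.
have rho : f m - g m + period_gap N * s = be ^+ N / (1 - be ^+ N) * D.
  apply/(mulIf (lt0r_neq0 p)).
  rewrite mulrDl E [_ * s * _]mulrAC gapE [RHS]mulrAC divfK ?lt0r_neq0 //.
  by rewrite expr2; ring.
have rhod : `|f m - g m + period_gap N * s| <= d.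
  rewrite {E}rho normrM ger0_norm ?divr_ge0 ?(ltW e2) ?(ltW p) //.
  by apply: le_trans gd; rewrite ler_piMl // ler_pdivrMr //; lra.
have /andP[gap0 gap1] := period_gap_bounds N1.
have e3 : be ^+ N.-1 <= be by apply: expr_le_base.
have gap2 : period_gap N <= kap.
  by apply: le_trans gap1 _; rewrite ler_piMr //; lra.
rewrite /deviation -/s; move: rhod; rewrite ler_norml => /andP[r1 r2].
have [sE|sE] : s = 1 \/ s = -1.
- move: neq; rewrite /s; case: (c m); case: (c m.+1) => //= _.
    by right; rewrite sub0r.
  by left; rewrite subr0.
- rewrite sE in r1 r2 *; rewrite ler_norml ler_normr.
  by apply/andP; split; [apply/orP; left|apply/andP; split]; lra.
- rewrite sE in r1 r2 *; rewrite ler_norml ler_normr.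
  by apply/andP; split; [apply/orP; right|apply/andP; split]; lra.
Qed.

Lemma short_difference_deviation c f g m d N : digit_system c f g ->
  (0 < d <= m)%N -> (d < N.-1)%N -> c m != c m.+1 ->
  (forall j, (0 < j < d)%N -> c (m - j)%N = c (m.+1 + j)%N) ->
  c (m - d)%N = c m.+1 -> c (m.+1 + d)%N = c m ->
  - be ^+ 2 <= g m <= be + be ^+ 2 -> - be ^+ 2 <= g (m - d)%N <= be + be ^+ 2 ->
  `|deviation c f g m| <= kap - period_gap N.
Proof.
have b0 := be0; have b3 := be3.
move=> sys dm dN; have [N1 d0] : (1 < N)%N /\ (0 < d)%N by lia.
move=> neq pal cl cr gm gmd.
have := digit_first_difference sys dm pal; rewrite cl cr.
have [_ _ fB _] := sys; have := fB m; have := fB (m + d)%N; rewrite /deviation.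
have /andP[gap0 gap1] := period_gap_bounds N1.
have e0 : 0 < be ^+ d by rewrite exprn_gt0.
have e1 : be ^+ N.-1 <= be * be ^+ d.
  by rewrite -exprS ler_wiXn2l ?(ltW be0) //; lra.
have e2 : kap * be ^+ N.-1 <= be ^+ d * (kap * be).
  by rewrite mulrCA ler_pM2l ?[_ * be]mulrC //; lra.
have e3 : be ^+ d <= be by apply: expr_le_base.
have e4 : be ^+ d * (kap * be) <= be * (kap * be).
  by rewrite ler_wpM2r // mulr_ge0 //; lra.
have b2 : be ^+ 2 <= be / 3 by rewrite expr2; nra.
rewrite expr2 in gm gmd b2.
set x := f (m + d)%N - _ => fd fm E.
have x1 : - (be + be * be) <= x <= be + be * be by rewrite /x; lra.
(* A closer difference weighs more than the palindrome by a factor of at least [1 / be]. The slack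
   [be ^+ 2] allowed for [g] is just affordable: [kap - be - be ^+ 2 >= kap * be] amounts to
   [3 * be <= 1]. *)
have main y : - (be + be * be) <= y -> period_gap N <= be ^+ d * (kap + y).
  move=> y1; apply: le_trans gap1 _; apply: le_trans e2 _.
  by rewrite ler_pM2l //; lra.
have b3_ge0 : 0 <= be * be * be by rewrite !mulr_ge0 ?(ltW be0).
have gap3 : period_gap N <= be * be by lra.
move: neq E; case: (c m); case: (c m.+1) => //= _ E; rewrite ler_norml.
- have xb : - (be + be * be) <= x by lra.
  have := main x xb; rewrite (_ : kap * (1 - 0) + x = kap + x) in E; last by ring.
  by rewrite -E; lra.
- have xb : - (be + be * be) <= - x by lra.
  have := main (- x) xb; rewrite (_ : kap * (0 - 1) + x = - (kap - x)) in E; last by ring.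
  by rewrite mulrN in E; lra.
Qed.

Lemma deviation_constant c f g M : digit_system c f g ->
  (forall m, (M <= m)%N -> c m.+1 = c m) ->
  forall d, 0 < d -> exists M', forall m, (M' <= m)%N -> `|deviation c f g m| <= d.
Proof.
have b0 := be0; have b3 := be3.
move=> [fE gE fB gB] cst d d0.
have per m : (M <= m)%N -> c (m + 1)%N = c m by rewrite addn1; apply: cst.
have [M1 small] := left_expansion_periodic gE gB per d0.
exists (M + M1).+1 => -[//|m] Mm; rewrite /deviation cst ?subrr ?mulr0 ?add0r; last by lia.
have f1 : f m.+2 = f m.+1.
  by have := right_expansion_periodic fE fB per (m := m.+1); rewrite addn1; apply; lia.
have gm := gE m; have fm := fE m.+1.
rewrite f1 !cst in fm; [|lia..].
have := small m ltac:(lia); rewrite addn1 !ler_norml => /andP[g1 g2].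
have E : (f m.+1 - g m.+1) * (1 - be) = be * (g m.+1 - g m) by lra.
by apply/andP; split; nra.
Qed.

(** At a transition the first mirror difference lies at distance [N.-1], where
    [palindrome_deviation] applies, or closer, where the modulus is no larger. Elsewhere the main
    term vanishes and the modulus is at most about [be]. *)
Lemma deviation_upper_limit c f g N K M : digit_system c f g ->
  christoffel N c -> markoff K M c ->
  upper_limit (fun m => `|deviation c f g m|) (kap - period_gap N).
Proof.
have b0 := be0; have b3 := be3.
move=> sys [N0 [M1 per] tr] mk; have [fE gE fB gB] := sys.
have [NE|N1] : N = 1%N \/ (1 < N)%N by lia.
  have -> : kap - period_gap N = 0.
    rewrite /period_gap NE expr0 expr1 mulr1 expr2 -mulrA divff ?mulr1 ?subrr //.
    by rewrite lt0r_neq0 //; lra.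
  have cst m : (M1 <= m)%N -> c m.+1 = c m by rewrite -addn1 -NE; apply: per.
  split=> d d0; have [M' small] := deviation_constant sys cst d0.
    by exists M' => m /small; rewrite add0r.
  by move=> M''; exists M'' => //; rewrite sub0r (le_trans _ (normr_ge0 _)) // oppr_le0 ltW.
have fper := right_expansion_periodic fE fB per.
have pal_dev d m : (M1 + N <= m)%N -> c m != c m.+1 ->
    (forall j, (0 < j < N.-1)%N -> c (m - j)%N = c (m.+1 + j)%N) ->
    `|g m - g (m - N)%N| <= d ->
    kap - period_gap N - d <= `|deviation c f g m| <= kap - period_gap N + d.
  move=> Mm neq pal gd; apply: palindrome_deviation => //.
  - by lia.
  - by rewrite -(per (m - N)%N) ?subnK //; lia.
  - by rewrite -(per (m - N.-1)%N); [congr c; lia|lia].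
  - by rewrite per //; lia.
  - by rewrite per //; lia.
  - by rewrite fper //; lia.
have /andP[gap0 gap1] := period_gap_bounds N1.
split=> d d0; have [M2 gper] := left_expansion_periodic gE gB per d0; last first.
  move=> M'; have [m [Mm neq pal]] := tr N1 (M' + M1 + M2 + N)%N.
  exists m; first by lia.
  suff /andP[] : kap - period_gap N - d <= `|deviation c f g m| <= kap - period_gap N + d.
    by [].
  apply: pal_dev => //; first by lia.
  by have := gper (m - N)%N; rewrite subnK; [apply|]; lia.
have [M3 gbd] := left_expansion_bounds gE gB d0.
have be2 : 0 < be ^+ 2 by rewrite exprn_gt0.
have [M4 gbe] := left_expansion_bounds gE gB be2.
exists (M + K + M1 + M2 + M3 + M4 + N)%N => m Mm.
have [m1 m2 m3 m4 m5] : [/\ M + K <= m, M1 + N <= m, M2 + N <= m, M3 <= m & M4 + K <= m]%N.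
  by clear -Mm; split; lia.
have gap2 : period_gap N <= kap * be.
  apply: le_trans gap1 _; rewrite ler_pM2l; last by clear -b3 b0; lra.
  by apply: expr_le_base; clear -N1; lia.
case: (eqVneq (c m) (c m.+1)) => [eqc|neq].
  rewrite /deviation eqc subrr mulr0 add0r ler_norml.
  have := fB m; have := gbd m m4; move: be2; rewrite expr2; clear -b0 b3 gap2 d0; lra.
have [d' [dK pal dl dr]] := mk m m1 neq.
(* A first difference at distance [N] or more is impossible: the letters at distance [N.-1] would
   agree, yet by periodicity they are the two letters of the transition. *)
have [dN|dN] := leqP N d'.
  have := pal N.-1 ltac:(clear -N1 dN; lia).
  have := per (m - N.-1)%N ltac:(clear -N1 m2; lia).
  rewrite (_ : m - N.-1 + N = m.+1)%N; last by clear -N1 m2; lia.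
  rewrite (_ : m.+1 + N.-1 = m + N)%N; last by clear -N1; lia.
  rewrite per; last by clear -m2; lia.
  by move=> e1 e2; rewrite e1 e2 eqxx in neq.
have [dE|dN'] := eqVneq d' N.-1.
  suff /andP[] : kap - period_gap N - d <= `|deviation c f g m| <= kap - period_gap N + d.
    by [].
  apply: pal_dev => //; first by rewrite -dE.
  by have := gper (m - N)%N; rewrite subnK; [apply|]; clear -m3; lia.
have dm : (0 < d' <= m)%N by clear -dK m1; lia.
have dlt : (d' < N.-1)%N by clear -dN dN' N1; lia.
have md : (M4 <= m - d')%N by clear -dK m5; lia.
have m4' : (M4 <= m)%N by clear -m5; lia.
have := short_difference_deviation sys dm dlt neq pal dl dr (gbe m m4') (gbe _ md).
by move=> /le_trans; apply; rewrite lerDl ltW.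
Qed.

End digit_systems.

(** * Passing between orbits and words *)

Lemma digit_system_of_orbit (R : realType) (be mu : R) (e : nat -> R) (s : nat -> int) :
  0 < be -> 3 * be < 1 -> mu * (1 + be) < be ->
  (forall m, `|e m| <= mu) ->
  (forall m, e m.+2 - (be^-1 + be) * e m.+1 + e m = - (s m.+1)%:~R) ->
  exists c f g, [/\ digit_system be c f g,
    forall m, deviation be c f g m = (be^-1 - be) * e m.+1 &
    forall m, f m = e m.+2 - be * e m.+1 + be * (c m.+1)%:R].
Proof.
move=> b0 b3 mulb ebd rec; have binv : be * be^-1 = 1 by rewrite mulfV // gt_eqF.
have bi0 : 0 < be^-1 by rewrite invr_gt0.
(* These combinations split the recurrence of order two into two of order one: [F] expands the later
   values of [s] and [G] the earlier ones. The bound on [mu] keeps both below [be] in modulus. *)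
pose F m := e m.+1 - be * e m; pose G m := e m - be * e m.+1.
have ebd' m : - mu <= e m <= mu by rewrite -ler_norml.
have Fbd m : - be < F m < be.
  by rewrite /F; have := ebd' m; have := ebd' m.+1; nra.
have Gbd m : - be < G m < be.
  by rewrite /G; have := ebd' m; have := ebd' m.+1; nra.
have FE m : F m = be * ((s m.+1)%:~R + F m.+1).
  rewrite -[(s m.+1)%:~R]opprK -rec /F.
  by rewrite -[e m.+1 in LHS]mul1r -binv; ring.
have GE m : G m.+1 = be * ((s m.+1)%:~R + G m).
  rewrite -[(s m.+1)%:~R]opprK -rec /G.
  by rewrite -[e m.+1 in LHS]mul1r -binv; ring.
have eE m : (s m.+1)%:~R + F m.+1 + G m = (be^-1 - be) * e m.+1.
  by rewrite -[(s m.+1)%:~R]opprK -rec /F /G; ring.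
have ale m : - (1 - be) < (be^-1 - be) * e m < 1 - be.
  have K0 : 0 < be^-1 - be by rewrite subr_gt0 -(ltr_pM2l b0) binv; nra.
  have Kmu : (be^-1 - be) * mu < 1 - be.
    rewrite -(ltr_pM2l b0) mulrA mulrBr binv; nra.
  have /andP[e1 e2] := ebd' m.
  by apply/andP; rewrite -(ler_pM2l K0) in e1; rewrite -(ler_pM2l K0) in e2; split; lra.
have sbd m : [\/ s m.+1 = 0, s m.+1 = 1 | s m.+1 = -1].
  have [s1 s2] : - 2 < (s m.+1)%:~R :> R /\ (s m.+1)%:~R < 2 :> R.
    have := FE m; have := Fbd m; have := Fbd m.+1.
    by split; rewrite -(ltr_pM2l b0); nra.
  have s1' : (- 2)%:~R < (s m.+1)%:~R :> R by rewrite mulrNz.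
  have s2' : (s m.+1)%:~R < (2%:Z)%:~R :> R by [].
  rewrite !ltr_int in s1' s2'.
  have [|[|]] : s m.+1 = 0 \/ s m.+1 = 1 \/ s m.+1 = -1 by lia.
  - by constructor 1.
  - by constructor 2.
  - by constructor 3.
(* [F m < 0] says that the next nonzero value of [s] after [m] is -1. By [ale] and the bound on [G],
   a value 1 of [s] makes the following [F] negative and a value -1 makes it nonnegative; this is
   the alternation. *)
pose c m := F m < 0.
have cE m : (s m.+1)%:~R = (c m.+1)%:R - (c m)%:R :> R.
  have := FE m; have := ale m.+1; rewrite -eE; have := Gbd m; have := Fbd m.+1; rewrite /c.
  case: (sbd m) => -> Fm1 Gm em FmE.
  - have -> : (F m < 0) = (F m.+1 < 0) by rewrite FmE add0r pmulr_rlt0.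
    by rewrite subrr.
  - have -> : (F m < 0) = false.
      by apply/negbTE; rewrite -leNgt FmE pmulr_rge0 //; lra.
    have -> : F m.+1 < 0 by lra.
    by rewrite subr0.
  - have -> : F m < 0 by rewrite FmE pmulr_rlt0 //; lra.
    have -> : (F m.+1 < 0) = false by apply/negbTE; rewrite -leNgt; lra.
    by rewrite sub0r.
(* Only [|G| < be] is known, hence the wide range allowed for [g]. *)
exists c, (fun m => F m.+1 + be * (c m.+1)%:R), (fun m => be * (c m)%:R - G m); split.
- split=> m.
  + by rewrite FE cE; ring.
  + by rewrite GE cE; ring.
  + by rewrite /c; case: ltP => /= [|] F0; have := Fbd m.+1; lra.
  + by have := Gbd m; case: (c m) => /=; lra.
- by move=> m; rewrite -eE cE /deviation; ring.
- by [].
Qed.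

Lemma expansion_exists (R : realType) (be : R) (c : nat -> bool) :
  0 < be -> 3 * be < 1 ->
  exists f : nat -> R, (forall m, f m = be * ((1 - be) * (c m.+2)%:R + f m.+1)) /\
    forall m, 0 <= f m <= be.
Proof.
move=> b0 b3.
pose t m n : R := (1 - be) * (c (m + n).+2)%:R * be ^+ n.+1.
have t_ge0 m n : 0 <= t m n by rewrite !mulr_ge0 ?ler0n ?exprn_ge0 //; lra.
have t_le m n : series (t m) n <= be * (1 - be ^+ n).
  elim: n => [|n IH]; first by rewrite /series /= big_geq // expr0 subrr mulr0.
  rewrite seriesSr; move: IH (t_ge0 m n); rewrite /t.
  have : 0 <= be ^+ n.+1 by rewrite exprn_ge0 // ltW.
  by rewrite [be ^+ n.+1]exprS; case: (c _) => /=; nra.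
have t_bd m n : 0 <= series (t m) n <= be.
  rewrite sumr_ge0 //=; apply: le_trans (t_le m n) _.
  by rewrite ler_piMr ?(ltW b0) // gerBl exprn_ge0 // ltW.
have t_cvg m : cvgn (series (t m)).
  apply: nondecreasing_is_cvgn.
    by apply/nondecreasing_seqP => n; rewrite seriesSr lerDl.
  by exists be => _ [n _ <-]; have /andP[] := t_bd m n.
exists (fun m => limn (series (t m))).
have rec m : limn (series (t m)) = be * ((1 - be) * (c m.+2)%:R + limn (series (t m.+1))).
  have E n : series (t m) n.+1 = be * ((1 - be) * (c m.+2)%:R + series (t m.+1) n).
    rewrite /series /= big_nat_recl // /t addn0 expr1 mulrDr mulr_sumr.
    congr (_ + _); first by rewrite mulrC.
    by apply: eq_bigr => i _; rewrite addSnnS [be ^+ i.+2]exprS; ring.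
  apply: cvg_lim => //; rewrite -(cvg_shiftS (series (t m))).
  rewrite (_ : [sequence _]_n = fun n => be * ((1 - be) * (c m.+2)%:R + series (t m.+1) n)).
    by apply: cvgM; [exact: cvg_cst|apply: cvgD; [exact: cvg_cst|exact: t_cvg]].
  by apply/funext => n; exact: E.
split=> // m; apply/andP; split.
  by apply: limr_ge => //; apply: nearW => n; have /andP[] := t_bd m n.
by apply: limr_le => //; apply: nearW => n; have /andP[] := t_bd m n.
Qed.

(* [c 0 = c 1 = false] makes the nearest integers of [xi] and [xi * al] vanish, which
   starts the integer recurrence of the following ones. *)
Lemma word_realization (R : realType) (al : R) (b : int) (c : nat -> bool) :
  3 < al -> b%:~R = al + al^-1 -> c 0%N = false -> c 1%N = false ->
  exists xi f g, [/\ digit_system al^-1 c f g, forall m, 0 <= g m <= al^-1,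
    xi = f 0%N / (al - al^-1) &
    forall m, exists u : int, xi * al ^+ m = u%:~R + deviation al^-1 c f g m / (al - al^-1)].
Proof.
move=> al3 bE c0 c1; have al0 : al != 0 by rewrite gt_eqF //; lra.
have b0 : 0 < al^-1 by rewrite invr_gt0; lra.
have b3 : 3 * al^-1 < 1 by rewrite -(ltr_pM2r (x := al)) ?mulfVK ?mul1r //; lra.
have binv : al * al^-1 = 1 by rewrite mulfV.
have [f [fE fB]] := expansion_exists c b0 b3.
set be := al^-1 in bE b0 b3 binv fE fB *.
have [g [g0 gE]] : exists g : nat -> R, g 0%N = 0 /\
    forall m, g m.+1 = be * ((1 - be) * (c m)%:R + g m).
  by exists (fix g m := if m is m'.+1 then be * ((1 - be) * (c m')%:R + g m') else 0).
have gB m : 0 <= g m <= be.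
  elim: m => [|m IH]; first by rewrite g0 lexx ltW.
  by rewrite gE; case: (c m) => /=; nra.
have sys : digit_system be c f g.
  by split=> // m; have := gB m; lra.
have ab : al - be != 0 by rewrite gt_eqF //; lra.
(* [e m] is to be the signed distance of [xi * al ^+ m] to an integer; it obeys the recurrence of
   the powers of [al] up to an integer. *)
pose e m := deviation be c f g m / (al - be).
have eE m : e m.+2 = b%:~R * e m.+1 - e m - ((c m.+2)%:R - (c m.+1)%:R).
  apply: (mulIf ab); rewrite bE /e 2!mulrBl -mulrA !divfK // /deviation.
  rewrite (fE m) (fE m.+1) !gE /be; field; rewrite al0 gt_eqF //=; nra.
have e1 : e 1%N = al * e 0%N.
  rewrite /e mulrA; congr (_ / _); rewrite /deviation gE g0 (fE 0%N) c0 c1 /be /=; field => //.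
exists (f 0%N / (al - be)); exists f, g; split=> //.
have xi0 : f 0%N / (al - be) = e 0%N.
  by rewrite /e /deviation g0 c0 c1 subrr mulr0 add0r subr0.
move=> m; rewrite xi0 -/(e m).
suff [] : (exists u : int, e 0%N * al ^+ m = u%:~R + e m) /\
          (exists u : int, e 0%N * al ^+ m.+1 = u%:~R + e m.+1) by [].
elim: m => [|m [[u IHu] [v IHv]]].
  by split; exists 0; rewrite add0r ?expr0 ?mulr1 // expr1 e1 mulrC.
split; first by exists v.
exists (b * v - u + ((c m.+2)%:Z - (c m.+1)%:Z)).
rewrite eE !(intrD, intrB, intrM).
have -> : e 0%N * al ^+ m.+2 = b%:~R * (e 0%N * al ^+ m.+1) - e 0%N * al ^+ m.
  by rewrite bE /be !exprS; field => //.
by rewrite IHu IHv; ring.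
Qed.

(** * Upper limits and distances to the nearest integer *)

Section limits_superior.
Variable R : realType.
Implicit Types (u : nat -> R) (v x : R).

Lemma bounded_unit_sequence u : (forall m, 0 <= u m <= 1) -> bounded_fun u.
Proof.
move=> u01; exists 1; split; first by rewrite num_real.
move=> M M1 m _; have := u01 m; rewrite /= ler_norml; lra.
Qed.

Lemma limn_sup_lt u x : (forall m, 0 <= u m <= 1) -> limn_sup u < x ->
  exists M, forall m, (M <= m)%N -> u m < x.
Proof.
move=> u01; have ub := bounded_unit_sequence u01; rewrite limn_supE //.
move=> /inf_lt [|_ [M _ <-] Mx].
  by exists (sups u 0%N); exists 0%N.
exists M => m Mm; apply: le_lt_trans Mx; apply: ub_le_sup; last by exists m.
exact/has_ubound_sdrop/bounded_fun_has_ubound.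
Qed.

Lemma upper_limit_limn_sup u v : (forall m, 0 <= u m <= 1) -> upper_limit u v ->
  limn_sup u = v.
Proof.
move=> u01 [ule uge]; have ub := bounded_unit_sequence u01; rewrite limn_supE //.
have ub' M : has_ubound (sdrop u M) by exact/has_ubound_sdrop/bounded_fun_has_ubound.
apply/eqP; rewrite eq_le; apply/andP; split; apply/ler_addgt0Pr => d d0.
  have [M HM] := ule d d0.
  apply: (@le_trans _ _ (sups u M)).
    by apply: ge_inf; [exact: bounded_fun_has_lbound_sups|exists M].
  by apply: ge_sup; [exists (u M); exists M => /=|move=> _ [m Mm <-]; exact: HM].
rewrite -lerBlDr; apply: lb_le_inf; first by exists (sups u 0%N); exists 0%N.
move=> _ [M _ <-]; have [m Mm um] := uge d d0 M.
by apply: le_trans um _; apply: ub_le_sup => //; exists m.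
Qed.

Lemma upper_limit_shift u v M : upper_limit (fun m => u (M + m)%N) v -> upper_limit u v.
Proof.
move=> [ule uge]; split=> d d0.
  have [M' HM] := ule d d0; exists (M + M')%N => m Mm.
  by have := HM (m - M)%N; rewrite subnKC; [apply|]; lia.
by move=> M'; have [m Mm um] := uge d d0 M'; exists (M + m)%N => //; lia.
Qed.

Lemma upper_limit_scale u v k : 0 < k -> upper_limit (fun m => k * u m) (k * v) ->
  upper_limit u v.
Proof.
move=> k0 [ule uge]; split=> d d0; have kd0 : 0 < k * d by rewrite mulr_gt0.
  by have [M HM] := ule _ kd0; exists M => m /HM; rewrite -mulrDr ler_pM2l.
by move=> M; have [m Mm um] := uge _ kd0 M; exists m => //; move: um; rewrite -mulrBr ler_pM2l.
Qed.

Lemma dist_int_ge0 (x : R) : 0 <= dist_int x.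
Proof. by apply: lb_le_inf; [exists `|x - 0%:~R|; exists 0|move=> _ [n _ <-]]. Qed.

Lemma dist_int_le (x : R) (n : int) : dist_int x <= `|x - n%:~R|.
Proof.
by apply: ge_inf; [exists 0 => _ [k _ <-]|exists n].
Qed.

Lemma dist_int_le1 (x : R) : dist_int x <= 1.
Proof.
apply: le_trans (dist_int_le x (Num.floor x)) _.
have := floor_itv x; rewrite intrD ler_norml; lra.
Qed.

Lemma dist_int_lt (x y : R) : dist_int x < y -> exists n : int, `|x - n%:~R| < y.
Proof.
move=> /inf_lt [|_ [n _ <-] ny]; last by exists n.
by exists `|x - 0%:~R|; exists 0.
Qed.

Lemma dist_int_near (x : R) (n : int) : `|x - n%:~R| <= 1 / 2 -> dist_int x = `|x - n%:~R|.
Proof.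
move=> xn; apply/eqP; rewrite eq_le dist_int_le /=.
apply: lb_le_inf; first by exists `|x - 0%:~R|; exists 0.
move=> _ [k _ <-]; have [->//|nk] := eqVneq k n.
have : 1 <= `|n%:~R - k%:~R| :> R.
  by rewrite -intrB -intr_norm -[1]/(1%:~R) ler_int; move: nk; lia.
have : `|n%:~R - k%:~R| <= `|x - n%:~R| + `|x - k%:~R| :> R.
  by rewrite [`|x - n%:~R|]distrC; exact: ler_distD.
lra.
Qed.
End limits_superior.

(** * The spectrum below the threshold *)

(** As [1 - be > be], a letter 1 outweighs all later letters, so the value determines the letters
    one by one. *)
Lemma expansion_inj (R : realType) (be : R) (c c' : nat -> bool) (f f' : nat -> R) :
  0 < be -> 3 * be < 1 ->
  (forall m, f m = be * ((1 - be) * (c m.+2)%:R + f m.+1)) -> (forall m, 0 <= f m <= be) ->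
  (forall m, f' m = be * ((1 - be) * (c' m.+2)%:R + f' m.+1)) ->
  (forall m, 0 <= f' m <= be) ->
  f 0%N = f' 0%N -> forall m, c m.+2 = c' m.+2.
Proof.
move=> b0 b3 fE fB f'E f'B E0.
have step m : f m = f' m -> c m.+2 = c' m.+2 /\ f m.+1 = f' m.+1.
  move=> E; have {E} : be * ((1 - be) * (c m.+2)%:R + f m.+1) =
    be * ((1 - be) * (c' m.+2)%:R + f' m.+1) by rewrite -fE -f'E.
  move/(mulfI (lt0r_neq0 b0)); have := fB m.+1; have := f'B m.+1.
  by case: (c m.+2); case: (c' m.+2) => /=; split=> //; lra.
suff eqf m : f m = f' m by move=> m; have [] := step m (eqf m).
by elim: m => // m /step[].
Qed.

(** The hypothesis is a linear equation for [xi] over Q(al). It concerns [e k.+1 - al^-1 * e k]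
    because this part depends on later letters only and so repeats exactly, while [e] itself does so
    only in the limit. *)
Lemma Q_adjoin_periodic_orbit (R : realType) (al xi : R) (M N k : nat) (u : nat -> int)
    (e := fun m => xi * al ^+ (M + m) - (u m)%:~R) :
  1 < al -> (0 < N)%N ->
  e (k + N).+1 - al^-1 * e (k + N)%N = e k.+1 - al^-1 * e k -> Q_adjoin al xi.
Proof.
move=> al1 N0 eN; have al0 : al != 0 by rewrite gt_eqF //; lra.
move=> K [[K1 KB KV] /(_ _ erefl) Kal].
have Kin x : (x \in mem K) = `[< K x >] by [].
have {}K1 : K 1 by move: K1; rewrite Kin => /asboolP.
have {}KB x y : K x -> K y -> K (x - y).
  by move=> Kx Ky; have := KB x y; rewrite !Kin => H; apply/asboolP/H; exact/asboolP.
have {}KV x y : K x -> K y -> K (x / y).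
  by move=> Kx Ky; have := KV x y; rewrite !Kin => H; apply/asboolP/H; exact/asboolP.
have KM x y : K x -> K y -> K (x * y).
  by move=> Kx Ky; rewrite -[y]invrK -[y^-1]mul1r; apply: (KV) => //; apply: (KV).
have K0 : K 0 by rewrite -(subrr 1); apply: KB.
have KD x y : K x -> K y -> K (x + y).
  by move=> Kx Ky; rewrite -[y]opprK -[- y]sub0r; apply: (KB) => //; apply: (KB).
have Knat n : K n%:R.
  by elim: n => [|n IH]; rewrite ?mulr0n // -natr1; apply: KD.
have Kint z : K z%:~R.
  case: z => n; first exact: Knat.
  by rewrite NegzE mulrNz -sub0r; apply: KB => //; exact: Knat.
have KX n : K (al ^+ n) by elim: n => [|n IH]; rewrite ?expr0 // exprS; apply: KM.
have KalV : K al^-1 by rewrite -[al^-1]mul1r; apply: KV.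
pose A := (al - al^-1) * (al ^+ (M + (k + N)) - al ^+ (M + k)).
have A0 : A != 0.
  rewrite mulf_neq0 //.
    rewrite gt_eqF // subr_gt0 (@lt_trans _ _ 1) // invf_lt1 //; lra.
  by rewrite subr_eq0 gt_eqF // ltr_eXn2l //; lia.
have E : xi * A = ((u (k + N).+1)%:~R - al^-1 * (u (k + N)%N)%:~R)
                  - ((u k.+1)%:~R - al^-1 * (u k)%:~R).
  have E1 m : e m.+1 - al^-1 * e m = xi * ((al - al^-1) * al ^+ (M + m))
      - ((u m.+1)%:~R - al^-1 * (u m)%:~R).
    by rewrite /e addnS exprS; ring.
  by rewrite !E1 in eN; rewrite /A; lra.
rewrite -(mulfK A0 xi) E; apply: (KV); last by apply: (KM); apply: (KB).
by apply: (KB); apply: (KB) => //; apply: (KM).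
Qed.

Section spectrum.
Variables (R : realType) (al : R) (b : int).
Hypotheses (al3 : 3 < al) (bE : b%:~R = al + al^-1).
Local Notation be := (al^-1).

Definition spectrum_value (N : nat) : R := (1 - be - period_gap be N) / (al - be).

Let be0 : 0 < be. Proof. by rewrite invr_gt0 (lt_trans _ al3). Qed.

Let al_neq0 : al != 0. Proof. by rewrite -invr_eq0 gt_eqF // be0. Qed.

Let be3 : 3 * be < 1.
Proof. by rewrite -(ltr_pM2r (x := al)) ?mulfVK ?mul1r // (lt_trans _ al3). Qed.

Let gap_gt2 : 2 < al - be. Proof. by have := al3; have := be3; lra. Qed.

Lemma spectrum_threshold : (1 - be) / (al - be) = 1 / (1 + al).
Proof.
have a3 := al3; have a0 := al_neq0; field.
by rewrite a0 !gt_eqF //=; nra.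
Qed.

Lemma dist_int_01 (xi : R) m : 0 <= dist_int (xi * al ^+ m) <= 1.
Proof. by rewrite dist_int_ge0 dist_int_le1. Qed.

Lemma small_limsup_classification xi : limsup_dist al xi < 1 / (1 + al) ->
  (exists2 N, (0 < N)%N & limsup_dist al xi = spectrum_value N) /\ Q_adjoin al xi.
Proof.
have a3 := al3; have b0 := be0; have b3 := be3; have g2 := gap_gt2.
have binv : al * be = 1 by rewrite mulfV // al_neq0.
move=> /midf_lt[]; set x := (_ + _) / 2 => lx x1.
have [M HM] := limn_sup_lt (dist_int_01 xi) lx.
have /choice[u Hu] : forall m, exists n : int, `|xi * al ^+ (M + m) - n%:~R| < x.
  by move=> m; apply/dist_int_lt/HM; lia.
pose e m := xi * al ^+ (M + m) - (u m)%:~R.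
pose s m := u m.+1 - b * u m + u m.-1.
(* [1 / (1 + al)] equals [be / (1 + be)], so this is the bound that [digit_system_of_orbit] asks
   for. *)
have xbd : x * (1 + be) < be.
  by move: x1; rewrite -(ltr_pM2r (x := 1 + al)) ?divfK //; nra.
have x4 : x <= 1 / 2 by nra.
have rec m : e m.+2 - (be^-1 + be) * e m.+1 + e m = - (s m.+1)%:~R.
  rewrite /e /s /= !(intrD, mulrNz, intrM).
  rewrite bE invrK !addnS !exprS; field.
  exact: al_neq0.
have ebd m : `|e m| <= x by apply/ltW/Hu.
have [c [f [g [sys devE fE]]]] := digit_system_of_orbit be0 be3 xbd ebd rec.
have eta0 : 0 < 1 - be - (al - be) * x.
  by move: x1; rewrite -spectrum_threshold ltr_pdivlMr ?(lt_trans _ g2) //; lra.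
have [|K [M' mk]] := deviation_markoff be0 be3 (M := 0%N) sys eta0.
  move=> m _; rewrite devE normrM invrK ger0_norm; last by lra.
  by have := ler_wpM2l (ltW (lt_trans (ltr0Sn R 1) g2)) (ebd m.+1); lra.
have [N chr] := markoff_christoffel mk; have [N0 [M1 per] _] := chr.
split; last first.
  apply: (@Q_adjoin_periodic_orbit _ al xi M N M1.+1 u) => //; first by lra.
  have [fE' _ fB _] := sys.
  have := right_expansion_periodic be0 be3 fE' fB per (leqnn M1).
  by rewrite !fE -!addSn per ?leqnSn // => /addIr.
exists N => //; apply: upper_limit_limn_sup => //; first exact: dist_int_01.
(* The shift is one more than [M] because the deviation at [m] belongs to [e m.+1]. *)
apply: (@upper_limit_shift _ _ _ M.+1); apply: (@upper_limit_scale _ _ _ (al - be)).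
  by lra.
rewrite /spectrum_value [_ * (_ / _)]mulrC divfK ?gt_eqF //; last by lra.
rewrite (_ : (fun m => _) = (fun m => `|deviation be c f g m|)).
  exact: (deviation_upper_limit be0 be3 sys chr mk).
apply/funext => m; rewrite devE normrM invrK ger0_norm; last by lra.
rewrite (@dist_int_near _ _ (u m.+1)) ?addSnnS //.
by apply: le_trans (ebd m.+1) x4.
Qed.
End spectrum.

(** * The words of period 0^(N-1) 1 *)

Lemma christoffel_dvdn N : (0 < N)%N ->
  christoffel N (fun m => [&& 1 < N, 0 < m & N %| m])%N.
Proof.
move=> N0; split=> //.
  by exists 1%N => m m0; rewrite dvdn_addl // addn_gt0 m0.
(* The witness stands just before a multiple of [N]: a transition 01 with only letters 0 around it
   up to distance [N - 2]. *)
move=> N1 M; exists (N * M.+2).-1; have NM : (M.+2 <= N * M.+2)%N by apply: leq_pmull.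
have nodvd r q : (0 < r < N)%N -> (N %| N * q + r)%N = false.
  by move=> /andP[r0 rN]; rewrite dvdn_addr ?dvdn_mulr // gtnNdvd.
have E : (N * M.+2 = N * M.+1 + N)%N by rewrite mulnSr.
split; first by lia.
  rewrite N1 /= prednK ?dvdn_mulr //=; last by lia.
  by rewrite (_ : (N * M.+2).-1 = N * M.+1 + N.-1)%N ?nodvd ?andbF; lia.
move=> j jN; rewrite prednK; last by lia.
rewrite nodvd; last by lia.
by rewrite (_ : (N * M.+2).-1 - j = N * M.+1 + (N.-1 - j))%N ?nodvd ?andbF; lia.
Qed.

Lemma markoff_dvdn N : (0 < N)%N ->
  markoff N.-1 N (fun m => [&& 1 < N, 0 < m & N %| m])%N.
Proof.
move=> N0 m Nm; have [N1|] := ltnP 1 N; last by [].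
have nodvd r q : (0 < r < N)%N -> (N %| N * q + r)%N = false.
  by move=> /andP[r0 rN]; rewrite dvdn_addr ?dvdn_mulr // gtnNdvd.
rewrite /= => neq; exists N.-1.
have mE : (m = N * (m %/ N) + m %% N)%N by rewrite mulnC -divn_eq.
have mlt := ltn_pmod m N0; set q := (m %/ N)%N in mE; set r := (m %% N)%N in mE mlt.
have m0 : (0 < m)%N by lia.
have q0 : (0 < q)%N by case: (posnP q) => // q0; move: mE; rewrite q0 muln0; lia.
rewrite m0 /= in neq *.
(* Transitions occur only at a multiple of [N] and just before one; both have their first difference
   at distance [N.-1]. *)
have [rE|rN] := eqVneq r 0%N.
  have mE' : (m = N * q)%N by rewrite mE rE addn0.
  have dm : (N %| m)%N by rewrite mE' dvdn_mulr.
  have dm1 : (N %| m.+1)%N = false by rewrite mE' -addn1 nodvd //; lia.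
  have mq : (m = N * q.-1 + N)%N by rewrite -mulnSr prednK.
  rewrite dm dm1; split; first by lia.
  - move=> j jN.
    rewrite (_ : m.+1 + j = N * q + j.+1)%N ?nodvd ?andbF; [|lia|lia].
    rewrite (_ : m - j = N * q.-1 + (N - j))%N ?nodvd ?andbF //; lia.
  - rewrite (_ : m - N.-1 = N * q.-1 + 1)%N ?nodvd ?andbF //; lia.
  - rewrite (_ : m.+1 + N.-1 = m + N)%N ?dvdn_addl ?dm ?addn_gt0 ?m0 //; lia.
have ndm : (N %| m)%N = false by rewrite mE nodvd //; lia.
have rE : (r = N.-1)%N.
  move: neq; rewrite ndm; case: (eqVneq r N.-1) => // rN1.
  by rewrite mE -addnS nodvd //; lia.
have m1E : (m.+1 = N * q.+1)%N by rewrite mE rE mulnS; lia.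
have dm1 : (N %| m.+1)%N by rewrite m1E dvdn_mulr.
rewrite ndm dm1; split; first by lia.
- move=> j jN; rewrite m1E nodvd ?andbF; last by lia.
  rewrite (_ : m - j = N * q + (N.-1 - j))%N ?nodvd ?andbF //; lia.
- rewrite (_ : m - N.-1 = N * q)%N ?dvdn_mulr ?muln_gt0 ?q0 ?N0 //; lia.
- rewrite m1E nodvd ?andbF //; lia.
Qed.

(** * Words with ever sparser letters 1 *)

Section sparse_words.
Variables (R : realType) (be : R).
Hypotheses (be0 : 0 < be) (be3 : 3 * be < 1).
Implicit Types (c : nat -> bool) (f g : nat -> R).

Lemma right_expansion_zeros c f m D :
  (forall m, f m = be * ((1 - be) * (c m.+2)%:R + f m.+1)) -> (forall m, 0 <= f m <= be) ->
  (forall j, (0 < j <= D)%N -> c (m.+1 + j)%N = false) -> f m <= be ^+ D.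
Proof.
have b0 := be0; have b3 := be3.
move=> fE fB; elim: D m => [|D IH] m zeros.
  by rewrite expr0; have := fB m; lra.
have := zeros 1%N isT; rewrite addn1 fE => ->.
rewrite mulr0 add0r exprS ler_pM2l //; apply: IH => j jD.
by rewrite addSnnS zeros //; lia.
Qed.

Lemma left_expansion_zeros c g m D :
  (forall m, g m.+1 = be * ((1 - be) * (c m)%:R + g m)) -> (forall m, 0 <= g m <= be) ->
  (D <= m)%N -> (forall j, (0 < j <= D)%N -> c (m - j)%N = false) -> g m <= be ^+ D.
Proof.
have b0 := be0; have b3 := be3.
move=> gE gB; elim: D m => [|D IH] m Dm zeros.
  by rewrite expr0; have := gB m; lra.
case: m => // m in Dm zeros *; have := zeros 1%N isT; rewrite subn1 /= gE => ->.
rewrite mulr0 add0r exprS ler_pM2l //; apply: IH => // j jD.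
by rewrite -subSS zeros //; lia.
Qed.

(** Sparsity puts a long run of 0 on both sides of each late letter 1. Hence at a transition the
    expansion that could lift the modulus above [1 - be] is negligible, and at 01 so is the one that
    lowers it. *)
Lemma sparse_deviation c f g : digit_system be c f g -> (forall m, 0 <= g m <= be) ->
  (forall m n, c m -> c n -> (m < n)%N -> (2 * m <= n + 2)%N) ->
  (forall M, exists2 m, (M <= m)%N & c m) ->
  upper_limit (fun m => `|deviation be c f g m|) (1 - be).
Proof.
have b0 := be0; have b3 := be3.
move=> [fE gE fB _] gB sparse inf.
have zeros m D : (D + 3 <= m)%N -> c m -> forall j, (0 < j <= D)%N -> c (m + j)%N = false.
  move=> mD cm j jD; apply/negP => cj.
  by have := sparse m (m + j)%N cm cj ltac:(lia); lia.
have zerosl m D : (2 * D + 3 <= m)%N -> c m ->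
    forall j, (0 < j <= D)%N -> c (m - j)%N = false.
  move=> mD cm j jD; apply/negP => cj.
  by have := sparse (m - j)%N m cj cm ltac:(lia); lia.
split=> d d0; have [D /(_ D (leqnn _)) HD] := expr_small be0 be3 d0.
  exists (2 * D + 3)%N => m mD; rewrite /deviation.
  have fm := fB m; have gm := gB m.
  have [cm1|cm1] := boolP (c m.+1); have [cm|cm] := boolP (c m) => /=.
  - by rewrite subrr mulr0 add0r ler_norml; clear -b0 b3 d0 fm gm; lra.
  - have : f m <= be ^+ D.
      apply: (right_expansion_zeros fE fB) => j jD.
      by apply: zeros jD => //; lia.
    by rewrite subr0 mulr1 ler_norml; clear -b0 b3 d0 fm gm HD; lra.
  - have : g m <= be ^+ D.
      apply: (left_expansion_zeros gE gB); first by lia.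
      by move=> j jD; apply: zerosl jD.
    by rewrite sub0r mulrN1 ler_norml; clear -b0 b3 d0 fm gm HD; lra.
  - by rewrite subrr mulr0 add0r ler_norml; clear -b0 b3 d0 fm gm; lra.
move=> M; have [[|m] mM cm] := inf (M + 2 * D + 10)%N; first by lia.
exists m; first by lia.
have cm0 : c m = false.
  by apply/negP => cm0; have := sparse m m.+1 cm0 cm ltac:(lia); lia.
rewrite /deviation cm cm0 subr0 mulr1 ler_normr.
have : g m <= be ^+ D.
  apply: (left_expansion_zeros gE gB); first by lia.
  move=> j jD; have := zerosl m.+1 D.+1 ltac:(lia) cm j.+1 ltac:(lia).
  by rewrite subSS.
by have := fB m; clear -b0 HD => fm gm; apply/orP; left; lra.
Qed.
End sparse_words.

(** The bit [t k] decides whether the [k]-th letter 1 stands at a power of two or one place later;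
    this freedom gives uncountably many sparse words. *)
Definition sparse_word (t : nat -> bool) (m : nat) : bool :=
  `[< exists k, m = (2 ^ k.+2 + t k)%N >].

Lemma sparse_word_gap t m n : sparse_word t m -> sparse_word t n -> (m < n)%N ->
  (2 * m <= n + 2)%N.
Proof.
move=> /asboolP[k ->] /asboolP[l ->] kl.
have {}kl : (k < l)%N.
  rewrite ltnNge; apply/negP; rewrite leq_eqVlt => /orP[/eqP lk|lk].
    by move: kl; rewrite lk ltnn.
  have : (2 ^ l.+3 <= 2 ^ k.+2)%N by rewrite leq_exp2l.
  have : (0 < 2 ^ l.+2)%N by rewrite expn_gt0.
  by move: kl; rewrite (expnS 2 l.+2); case: (t k); case: (t l) => /=; lia.
have : (2 ^ k.+3 <= 2 ^ l.+2)%N by rewrite leq_exp2l.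
by rewrite (expnS 2 k.+2); case: (t k); case: (t l) => /=; lia.
Qed.

Lemma sparse_word_infinite t M : exists2 m, (M <= m)%N & sparse_word t m.
Proof.
exists (2 ^ M.+2 + t M)%N; last by apply/asboolP; exists M.
by have := ltn_expl M.+2 (isT : 1 < 2)%N; lia.
Qed.

Lemma sparse_word_inj t t' : (forall m, sparse_word t m.+2 = sparse_word t' m.+2) -> t =1 t'.
Proof.
have key u k : sparse_word u (2 ^ k.+2 + 1)%N = u k.
  apply/asboolP/idP => [[l]|uk]; last by exists k; rewrite uk.
  (* All these powers are even, so a letter 1 at an odd place comes from a true bit. *)
  have ev i : odd (2 ^ i.+2)%N = false by rewrite oddX.
  case E : (u l) => /= kl; last by have := ev k; have := ev l; lia.
  by move: kl => /addIn/eqP; rewrite eqn_exp2l // => /eqP[->].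
move=> E k; rewrite -(key t) -(key t').
have : (2 <= 2 ^ k.+2)%N by rewrite -[leqLHS]expn1 leq_exp2l.
by move=> /subnKC <-; rewrite !addSn; apply: E.
Qed.

(** * Realizing the spectrum values and the threshold *)

Section realizations.
Variables (R : realType) (al : R) (b : int).
Hypotheses (al3 : 3 < al) (bE : b%:~R = al + al^-1).
Local Notation be := (al^-1).

(** The deviation has modulus at most 1 and [al - be > 2], so [u] is a nearest integer. *)
Lemma limsup_of_deviation xi c f g v : digit_system be c f g ->
  (forall m, 0 <= g m <= be) ->
  (forall m, exists u : int, xi * al ^+ m = u%:~R + deviation be c f g m / (al - be)) ->
  upper_limit (fun m => `|deviation be c f g m|) v ->
  limsup_dist al xi = v / (al - be).
Proof.
have a3 := al3; have be1 : be < 1 by rewrite invf_lt1; lra.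
have g2 : 2 < al - be by lra.
have g0 : 0 < al - be by lra.
move=> [_ _ fB _] gB orb lim; apply: upper_limit_limn_sup.
  by move=> m; rewrite dist_int_ge0 dist_int_le1.
apply: (@upper_limit_scale _ _ _ (al - be)) => //.
rewrite mulrC divfK ?gt_eqF //.
rewrite (_ : (fun m => _) = (fun m => `|deviation be c f g m|)) //.
apply/funext => m; have [u uE] := orb m.
have dev1 : `|deviation be c f g m| <= 1.
  have := fB m; have := gB m; rewrite /deviation ler_norml.
  by case: (c m); case: (c m.+1) => /=; clear -be1; lra.
rewrite (@dist_int_near _ _ u) uE [_ + _ - _]addrC addKr normrM normfV (gtr0_norm g0).
  by rewrite mulrC divfK ?gt_eqF.
by rewrite ler_pdivrMr //; lra.
Qed.

Lemma periodic_realization N : (0 < N)%N -> exists xi, limsup_dist al xi = spectrum_value al N.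
Proof.
move=> N0; have a3 := al3; have a0 : 0 < al by lra.
have b0 : 0 < be by rewrite invr_gt0.
have b3 : 3 * be < 1 by rewrite -(ltr_pM2r (x := al)) ?mulfVK ?mul1r // gt_eqF.
(* The letter at 0, and the whole word when [N = 1], are cleared because [word_realization] wants
   [c 0] and [c 1] to be false. *)
pose c m := [&& 1 < N, 0 < m & N %| m]%N.
have c0 : c 0%N = false by rewrite /c ltnn andbF.
have c1 : c 1%N = false.
  by rewrite /c dvdn1 /=; case: ltngtP.
have [xi [f [g [sys gB _ orb]]]] := word_realization al3 bE c0 c1.
exists xi; apply: (limsup_of_deviation sys gB orb).
exact: (deviation_upper_limit b0 b3 sys (christoffel_dvdn N0) (markoff_dvdn N0)).
Qed.

Lemma threshold_uncountable :
  ~ countable [set xi : R | limsup_dist al xi = 1 / (1 + al)].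
Proof.
have a3 := al3; have a0 : 0 < al by lra.
have b0 : 0 < be by rewrite invr_gt0.
have b3 : 3 * be < 1 by rewrite -(ltr_pM2r (x := al)) ?mulfVK ?mul1r // gt_eqF.
have small t m : (m < 2)%N -> sparse_word t m = false.
  move=> m2; apply/asboolP => -[k mE].
  have : (2 ^ 2 <= 2 ^ k.+2)%N by rewrite leq_exp2l.
  by rewrite mE in m2; lia.
have /choice[Xi HXi] : forall t : nat -> bool, exists xi,
    limsup_dist al xi = 1 / (1 + al) /\ exists f : nat -> R,
    [/\ forall m, f m = be * ((1 - be) * (sparse_word t m.+2)%:R + f m.+1),
      forall m, 0 <= f m <= be & xi = f 0%N / (al - be)].
  move=> t.
  have [xi [f [g [sys gB xiE orb]]]] :=
    word_realization al3 bE (small t 0%N isT) (small t 1%N isT).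
  exists xi; split; last by have [fE _ fB _] := sys; exists f.
  rewrite (limsup_of_deviation sys gB orb (v := 1 - be)) ?spectrum_threshold //.
  exact: (sparse_deviation b0 b3 sys gB (sparse_word_gap (t := t)) (sparse_word_infinite t)).
have Xi_inj t t' : Xi t = Xi t' -> t =1 t'.
  have [_ [f [fE fB ->]]] := HXi t; have [_ [f' [f'E f'B ->]]] := HXi t'.
  move=> /mulIf E; apply: sparse_word_inj; apply: (expansion_inj b0 b3 fE fB f'E f'B).
  by apply: E; rewrite invr_eq0 gt_eqF //; lra.
move=> /countable_injP[h h_inj].
have {}h_inj t t' : h (Xi t) = h (Xi t') -> t =1 t'.
  by move=> /h_inj E; apply/Xi_inj/E; rewrite inE /=; have [] := HXi t; have [] := HXi t'.
(* Cantor's diagonal: by injectivity [t0] takes, at the code of each [t], the opposite of the value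
   of [t] there. *)
pose t0 n := `[< exists2 t : nat -> bool, h (Xi t) = n & t n = false >].
have : t0 (h (Xi t0)) = ~~ t0 (h (Xi t0)).
  apply/asboolP/idP => [[t /h_inj E]|/negbTE E]; last by exists t0.
  by rewrite E => ->.
by case: (t0 _).
Qed.
End realizations.

(** * Quadratic units and the sequences p, q *)

(** The gcd of [f] and [g] has the root [x], so it is not constant and must be associated with
    [f]. *)
Lemma irreducible_dvd (R : realType) (f g : {poly rat}) (x : R) :
  irreducible_poly f -> root (map_poly (ratr : rat -> R) f) x ->
  root (map_poly (ratr : rat -> R) g) x -> f %| g.
Proof.
move=> [_ irr] fx gx; have dx : root (map_poly (ratr : rat -> R) (gcdp f g)) x.
  by rewrite gcdp_map root_gcd fx gx.
have d1 : size (gcdp f g) != 1%N.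
  apply/eqP => /eqP/size_poly1P[c c0 dE].
  by move: dx; rewrite dE map_polyC rootC fmorph_eq0 (negbTE c0).
have := irr _ d1 (dvdp_gcdl f g); rewrite /eqp => /andP[_ fd].
exact: dvdp_trans fd (dvdp_gcdr f g).
Qed.

Lemma map_ratr_intr (R : realType) (g : {poly int}) :
  map_poly (ratr : rat -> R) (map_poly intr g) = map_poly intr g.
Proof. by rewrite -map_poly_comp; apply: eq_map_poly => z /=; rewrite ratr_int. Qed.

Lemma int_mul_eq1 (m n : int) : m * n = 1 -> m = 1 \/ m = -1.
Proof.
move=> mn; have : m \is a GRing.unit by apply/unitrPr; exists n.
by case/orP => /eqP ->; [left|right].
Qed.

(** By Gauss's lemma an integer multiple-free form [p] of [f] divides a monic integer polynomial;
    its leading coefficient is then 1 or -1. *)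
Lemma monic_int_minpoly (R : realType) (f : {poly rat}) (x : R) :
  is_minpolyQ f x -> algebraic_integer x ->
  exists2 h : {poly int}, h \is monic & f = map_poly intr h.
Proof.
move=> [fm irr fx] [g gm gx].
have /dvdpP_rat_int[p [a a0 fE] [r gE]] : f %| map_poly intr g.
  by apply: irreducible_dvd irr fx _; rewrite map_ratr_intr.
have lead1 : lead_coef p * lead_coef r = 1 by rewrite -lead_coefM -gE; exact/monicP.
have leadf : a * (lead_coef p)%:~R = 1.
  by have := monicP fm; rewrite fE lead_coefZ lead_coef_map_inj //; exact: intr_inj.
have aE : a = (lead_coef p)%:~R.
  move: leadf; case: (int_mul_eq1 lead1) => ->; first by rewrite mulr1.
  by rewrite mulrN1 => <-; rewrite mulrN1z opprK.
exists (lead_coef p *: p); last by rewrite linearZ fE aE.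
apply/monicP; rewrite lead_coefZ.
by case: (int_mul_eq1 lead1) => ->; rewrite ?mulrNN mulr1.
Qed.

(** For monic [h] the reversed polynomial has constant coefficient 1, which is how the integrality
    of the inverse gets used. *)
Lemma root_reverse (R : realType) (x : R) (h : {poly int}) : x != 0 -> h != 0 ->
  root (map_poly intr h) x^-1 ->
  root (map_poly (intr : int -> R) (\poly_(i < size h) h`_((size h).-1 - i))) x.
Proof.
move=> x0 h0; have [n nE] : exists n, size h = n.+1.
  by exists (size h).-1; rewrite prednK // lt0n size_poly_eq0.
rewrite /root => /eqP hx; apply/eqP; rewrite -[RHS](mulr0 (x ^+ n)) -hx nE /=.
set p := \poly_(i < _) _.
have sp : (size (map_poly (intr : int -> R) p) <= n.+1)%N.
  by apply: leq_trans (size_poly _ _) _; apply: size_poly.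
have sh : (size (map_poly (intr : int -> R) h) <= n.+1)%N by rewrite -nE size_poly.
rewrite (horner_coef_wide x sp) (horner_coef_wide x^-1 sh) mulr_sumr.
rewrite (reindex_inj rev_ord_inj) /=; apply: eq_bigr => i _.
have ile : (i <= n)%N by rewrite -ltnS.
rewrite !coef_map coef_poly subSS ltnS leq_subr subKn //= exprVn.
have -> : x ^+ n = x ^+ (n - i) * x ^+ i by rewrite -exprD subnK.
by rewrite mulrCA mulfK // expf_neq0.
Qed.

Lemma unit_quadratic_root (R : realType) (al al2 : R) :
  quadratic_unit al -> conjugate_of al al2 -> 0 < al -> 0 < al2 ->
  exists b : int, root ('X^2 - b%:~R *: 'X + 1 : {poly R}) al.
Proof.
move=> [[f' [fm' irr' fx'] sf'] [al0 int_al int_alV]] [neq [f fal fal2]] alp al2p.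
have [fm irr fx] := fal; have [_ _ fx2] := fal2.
have sf : size f = 3%N.
  have d1 := irreducible_dvd irr fx fx'; have d2 := irreducible_dvd irr' fx' fx.
  by rewrite -sf'; apply: eqp_size; rewrite /eqp d1 d2.
have [h hm fE] := monic_int_minpoly fal int_al.
have sh : size h = 3%N by rewrite -sf fE size_rat_int_poly.
have h2 : h`_2 = 1 by have := monicP hm; rewrite lead_coefE sh.
have ev x : root (map_poly (ratr : rat -> R) f) x ->
    x ^+ 2 + (h`_1)%:~R * x + (h`_0)%:~R = 0.
  rewrite fE map_ratr_intr /root (@horner_coef_wide _ 3); last by rewrite -sh size_poly.
  rewrite !big_ord_recr big_ord0 /= !coef_map /= h2 expr0 expr1 => /eqP.
  by rewrite add0r mulr1 mul1r => E; rewrite -[RHS]E; ring.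
have E1 := ev _ fx; have E2 := ev _ fx2.
have prod : al * al2 = (h`_0)%:~R.
  have : (al - al2) * (al + al2 + (h`_1)%:~R) = 0 by lra.
  by move/eqP; rewrite mulf_eq0 subr_eq0 eq_sym (negbTE neq) /= => /eqP E; nra.
have h0p : 0 < h`_0 by rewrite -(ltr_int R) -prod mulr_gt0.
(* The integrality of [al^-1] makes the constant coefficient 1 or -1, and the positivity of both
   roots gives its sign. *)
have h0 : h`_0 = 1.
  have [g gm gx] := int_alV.
  have /dvdpP_int[r rE] : h %| \poly_(i < size g) g`_((size g).-1 - i).
    rewrite -dvdp_rat_int -fE; apply: irreducible_dvd irr fx _.
    by rewrite map_ratr_intr; apply: root_reverse => //; apply: monic_neq0.
  have : (\poly_(i < size g) g`_((size g).-1 - i))`_0 = 1.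
    by rewrite coef_poly size_poly_gt0 monic_neq0 // subn0 -lead_coefE; apply/monicP.
  rewrite rE coef0M => /int_mul_eq1 u1.
  have u2 : zcontents h * lead_coef (zprimitive h) = 1.
    by rewrite -lead_coefZ -zpolyEprim; apply/monicP.
  move: h0p; rewrite [h]zpolyEprim coefZ.
  by case: u1 => ->; case: (int_mul_eq1 u2) => ->.
exists (- h`_1); apply/eqP; rewrite h0 in E1; rewrite -[RHS]E1 !hornerE mulrNz.
by ring.
Qed.

(** * Closed forms, monotonicity and convergence *)

Lemma spectrum_valueE (R : realType) (al : R) n : 3 < al ->
  spectrum_value al n.+1 = (al ^+ n.+1 - al) / ((1 + al) * (al ^+ n.+1 - 1)).
Proof.
move=> al3; rewrite /spectrum_value /period_gap /= !exprVn !exprS.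
have y1 : 1 <= al ^+ n by rewrite exprn_ege1 //; lra.
set y := al ^+ n in y1 *; have y0 : y != 0 by rewrite gt_eqF //; lra.
have ay : 3 < al * y by nra.
field; rewrite y0 !gt_eqF //=; nra.
Qed.

Lemma even_subsequence (R : realType) (al : R) (b : int) (u : nat -> int) (A B : R) :
  1 < al -> b%:~R = al + al^-1 -> even_odd_recurrence b u ->
  (u 0%N)%:~R = A + B -> (u 2%N)%:~R = A * al + B * al^-1 ->
  forall k, (u (2 * k)%N)%:~R = A * al ^+ k + B * al^-1 ^+ k.
Proof.
move=> al1 bE rec u0 u2; have al0 : al != 0 by rewrite gt_eqF //; lra.
move=> k; suff [] : (u (2 * k)%N)%:~R = A * al ^+ k + B * al^-1 ^+ k /\
    (u (2 * k.+1)%N)%:~R = A * al ^+ k.+1 + B * al^-1 ^+ k.+1 by [].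
elim: k => [|k [IH1 IH2]]; first by rewrite muln0 u0 muln1 u2 !expr0 !expr1 !mulr1.
split=> //; have [] := rec k.+1 isT.
rewrite (_ : 2 * k.+1 + 2 = 2 * k.+2)%N; last by lia.
rewrite (_ : 2 * k.+1 - 2 = 2 * k)%N; last by lia.
by move=> -> _; rewrite intrD mulrNz intrM bE IH1 IH2 !exprS; field.
Qed.

Lemma ratio_spectrum_value (R : realType) (al : R) (b : int) (p q : nat -> int) :
  3 < al -> b%:~R = al + al^-1 ->
  p 0%N = 0 -> p 2%N = 1 -> even_odd_recurrence b p ->
  q 0%N = 1 -> q 2%N = 1 + b -> even_odd_recurrence b q ->
  forall n, (p n)%:~R / (q n)%:~R = spectrum_value al n.+1.
Proof.
move=> al3 bE p0 p2 prec q0 q2 qrec n.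
have al1 : 1 < al by lra.
have al0 : al != 0 by rewrite gt_eqF //; lra.
have be0 : 0 < al^-1 by rewrite invr_gt0; lra.
have binv : al * al^-1 = 1 by rewrite mulfV.
have aa1 : al * al - 1 != 0 by rewrite gt_eqF //; nra.
have a1 : al - 1 != 0 by rewrite gt_eqF //; lra.
(* The coefficients solve [A + B = u 0] and [A * al + B * al^-1 = u 2]. *)
have pE := @even_subsequence R al b p (1 / (al - al^-1)) (- 1 / (al - al^-1)) al1 bE prec.
have qE := @even_subsequence R al b q (al / (al - 1)) (- 1 / (al - 1)) al1 bE qrec.
have {}pE k : (p (2 * k)%N)%:~R = (al ^+ k - al^-1 ^+ k) / (al - al^-1).
  by rewrite pE ?p0 ?p2; [ring|field; rewrite ?al0 ?aa1|field; rewrite ?al0 ?aa1].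
have {}qE k : (q (2 * k)%N)%:~R = (al ^+ k.+1 - al^-1 ^+ k) / (al - 1).
  rewrite qE ?q0 ?q2 ?intrD ?bE; first by rewrite exprS; ring.
    by field.
  by field; rewrite al0.
rewrite spectrum_valueE // -[n]odd_double_half -mul2n; set k := n./2.
have x1 : 1 <= al ^+ k by rewrite exprn_ege1 //; lra.
have x2 : al ^+ (2 * k) = al ^+ k * al ^+ k by rewrite mul2n -addnn exprD.
have x0 : al ^+ k != 0 by rewrite gt_eqF //; lra.
case: (odd n) => /=.
  have [_] := prec k.+1 isT; have [_] := qrec k.+1 isT.
  rewrite (_ : 2 * k.+1 - 2 = 2 * k)%N; last by lia.
  rewrite (_ : 2 * k.+1 - 1 = 1 + 2 * k)%N; last by lia.
  move=> -> ->; rewrite !intrD !pE !qE !exprVn add1n !exprS x2.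
  set x := al ^+ k in x0 x1 *; have ax : 3 < al * x by nra.
  have -> : (x - x^-1) / (al - al^-1) + (al * x - (al * x)^-1) / (al - al^-1) =
            (al * x - x^-1) / (al - 1) by field; rewrite ?x0 ?al0 ?aa1 ?a1.
  have -> : (al * x - x^-1) / (al - 1) + (al * (al * x) - (al * x)^-1) / (al - 1) =
            (1 + al) * (al * x - (al * x)^-1) / (al - 1).
    by field; rewrite ?x0 ?al0 ?aa1 ?a1.
  have axx : al * x * (al * x) - 1 != 0 by rewrite gt_eqF //; nra.
  have a1' : 1 + al != 0 by rewrite gt_eqF //; lra.
  field; rewrite x0 al0 a1 a1' andbT /= !mulrA.
  by rewrite -[al * al * x]mulrA [al * (al * x)]mulrC -mulrA axx.
rewrite add0n pE qE !exprVn !exprS x2; set x := al ^+ k in x0 x1 *.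
have axx : al * x * x - 1 != 0 by rewrite gt_eqF //; nra.
have a1' : 1 + al != 0 by rewrite gt_eqF //; lra.
by field; rewrite x0 al0 a1 a1' mulrA axx aa1.
Qed.

Lemma spectrum_value_gap (R : realType) (al : R) n : 3 < al ->
  0 < 1 / (1 + al) - spectrum_value al n.+2 <= al^-1 ^+ n.+1.
Proof.
move=> al3; have b0 : 0 < al^-1 by rewrite invr_gt0; lra.
have binv : al * al^-1 = 1 by rewrite mulfV // gt_eqF //; lra.
have b3 : 3 * al^-1 < 1 by nra.
have /andP[gap0 gap1] := period_gap_bounds b0 b3 (isT : (1 < n.+2)%N).
have e0 : 0 < al^-1 ^+ n.+1 by rewrite exprn_gt0.
have ab : 1 < al - al^-1 by lra.
rewrite -spectrum_threshold // /spectrum_value -mulrBl opprB addrCA subrr addr0.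
apply/andP; split; first by rewrite divr_gt0 //; lra.
rewrite ler_pdivrMr; last by lra.
apply: le_trans gap1 _; rewrite [n.+2.-1]/= mulrC ler_pM2l //; lra.
Qed.

Lemma spectrum_value_lt (R : realType) (al : R) n : 3 < al ->
  spectrum_value al n.+1 < spectrum_value al n.+2.
Proof.
move=> al3; rewrite !spectrum_valueE // [al ^+ n.+2]exprS.
have y1 : 3 < al ^+ n.+1.
  by rewrite (lt_le_trans al3) // -[leLHS]expr1 ler_weXn2l //; lra.
set y := al ^+ n.+1 in y1 *; have ay : 9 < al * y by nra.
rewrite ltr_pdivrMr; last by rewrite mulr_gt0; lra.
rewrite mulrAC ltr_pdivlMr; last by rewrite mulr_gt0; lra.
(* This is the difference of the two sides after cross-multiplication. *)
have : 0 < (1 + al) * y * ((al - 1) * (al - 1)) by rewrite !mulr_gt0; lra.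
by lra.
Qed.

Lemma spectrum_value_itv (R : realType) (al : R) n : 3 < al ->
  0 <= spectrum_value al n.+1 <= 1 / (1 + al).
Proof.
move=> al3; have t0 : 0 <= 1 / (1 + al) by rewrite divr_ge0 //; lra.
have v0 : spectrum_value al 1 = 0 by rewrite spectrum_valueE // expr1 subrr mul0r.
have inc : increasing_seq (fun n => spectrum_value al n.+1).
  by apply/increasing_seqP => m; apply: spectrum_value_lt.
apply/andP; split; first by rewrite -v0 (inc 0%N n).
case: n => [|n]; first by rewrite v0.
by have := spectrum_value_gap n al3; lra.
Qed.

Theorem theorem4p1 (R : realType) (alpha alpha2 : R)
    (alpha_gt3 : 3 < alpha)
    (alpha_unit : quadratic_unit alpha)
    (alpha2_conj : conjugate_of alpha alpha2)
    (alpha2_gt0 : 0 < alpha2) :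
  (exists b : int, root ('X^2 - b%:~R *: 'X + 1 : {poly R}) alpha) /\
  (forall (b : int) (p q : nat -> int),
    root ('X^2 - b%:~R *: 'X + 1 : {poly R}) alpha ->
    p 0%N = 0 -> p 2%N = 1 -> even_odd_recurrence b p ->
    q 0%N = 1 -> q 2%N = 1 + b -> even_odd_recurrence b q ->
    let r : nat -> R := fun n => (p n)%:~R / (q n)%:~R in
    [/\ increasing_seq r,
        r n @[n --> \oo] --> 1 / (1 + alpha),
        range (limsup_dist alpha) `&` `[0, 1 / (1 + alpha)]
          = range r `|` [set 1 / (1 + alpha)],
        (forall n : nat,
          [set xi : R | limsup_dist alpha xi = r n] `<=` Q_adjoin alpha) &
        ~ countable [set xi : R | limsup_dist alpha xi = 1 / (1 + alpha)]]).
Proof.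
have al0 : 0 < alpha by apply: lt_trans alpha_gt3.
split; first exact: unit_quadratic_root alpha_unit alpha2_conj al0 alpha2_gt0.
move=> b p q bal p0 p2 prec q0 q2 qrec r.
have bE : b%:~R = alpha + alpha^-1.
  apply: (mulIf (lt0r_neq0 al0)); rewrite mulrDl mulVf ?gt_eqF //.
  by move: bal; rewrite /root !hornerE => /eqP; lra.
have rE : r = fun n => spectrum_value alpha n.+1.
  by apply/funext => n; rewrite /r (ratio_spectrum_value alpha_gt3 bE p0 p2 prec).
have b0 : 0 < alpha^-1 by rewrite invr_gt0.
have b3 : 3 * alpha^-1 < 1.
  by rewrite -(ltr_pM2r al0) mulfVK ?mul1r // gt_eqF.
have below n : spectrum_value alpha n.+1 < 1 / (1 + alpha).
  apply: lt_le_trans (spectrum_value_lt n alpha_gt3) _.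
  by have /andP[] := spectrum_value_itv n.+1 alpha_gt3.
rewrite {}rE {r}; split.
- by apply/increasing_seqP => n; apply: spectrum_value_lt.
- apply/cvgrPdist_lt => eps eps0; have [K HK] := expr_small b0 b3 eps0.
  (* Term 0 is skipped, as [spectrum_value_gap] starts at period 2. *)
  exists K.+1 => // -[|n] //= Kn.
  have /andP[g0 g1] := spectrum_value_gap n alpha_gt3.
  by rewrite gtr0_norm //; apply: le_lt_trans g1 (HK _ (ltnW Kn)).
- apply/seteqP; split=> [x [[xi _ <-]] /=|x [[n _ <-]|->]].
  + rewrite in_itv /= => /andP[_]; rewrite le_eqVlt => /orP[/eqP ->|lt]; first by right.
    have [[N N0 ->] _] := small_limsup_classification alpha_gt3 bE lt.
    by left; exists N.-1; rewrite ?prednK.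
  + have [xi xiE] := periodic_realization alpha_gt3 bE (ltn0Sn n).
    split; first by exists xi.
    by rewrite /= in_itv /= spectrum_value_itv.
  + split; last by rewrite /= in_itv /= lexx divr_ge0 //; lra.
    (* The threshold is attained because the set of its [xi] is uncountable, hence nonempty. *)
    apply: contrapT => nex; apply: (threshold_uncountable alpha_gt3 bE).
    rewrite (_ : [set _ | _] = set0) //.
    by apply/seteqP; split=> // xi xiE; apply: nex; exists xi.
- move=> n xi xiE.
  by have [] := small_limsup_classification (xi := xi) alpha_gt3 bE; rewrite ?xiE.
- exact: threshold_uncountable alpha_gt3 bE.
Qed.
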